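(* For every integer $m\ge2$ and each of the species $17, 19, 21, 25, 27$ and $29$, there are isonemal fabrics of that species that can be perfectly coloured by thick striping with $2m$ colours (the same set of colours for warps and wefts) in such a way that the redundant blocks are arranged as a doubled $(2m-1)/1$ twill.
   Context: Cells are unit squares $[i,i+1]\times[j,j+1]$ tessellating the plane; vertical strips are warps, horizontal strips (rows) are wefts. A prefabric assigns to each cell which crossing strand is on top; its design colours a cell dark if the warp is on top; a fabric is a prefabric that does not fall apart. With $\tau$ reflection in the plane of the fabric, the symmetry group $G_1$ consists of pairs $(t,r)$, $t$ a plane isometry preserving the cell tessellation and $r\in\{e,\tau\}$, with $t$ mapping the over/under relation to itself ($r=e$, side-preserving) or its reverse ($r=\tau$); $H_1$ is the side-preserving subgroup. Isonemal: periodic with $G_1$ transitive on all strands; order: the period of the design along a strand. Species: Roth classified the symmetry groups of isonemal prefabrics of order greater than four into 39 types numbered 1–39, each type being the pair (crystallographic type of $G_1$, crystallographic type of $H_1$); ''species $n$'' means the symmetry group is of Roth type $n$ (Thomas's refinement into subspecies such as $17_e$, $25_o$ further subdivides these). Thick striping gives each warp pair $[2a,2a+2]\times\mathbb{R}$ and weft pair $\mathbb{R}\times[2b,2b+2]$ one colour; a block is $[2a,2a+2]\times[2b,2b+2]$, and it is redundant if its warp pair and weft pair have the same colour. The $(c-1)/1$ twill is the order-$c$ design in which, up to a symmetry of the square grid, cell $(i,j)$ is dark exactly when $i-j\equiv0\pmod c$; its double is obtained by replacing each cell by a $2\times2$ block of the same colour. An element $(t,r)\in G_1$ is a colour symmetry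 if for each colour $t$ maps all strands of that colour onto strands of one common colour; the colouring is perfect if every element of $G_1$ is a colour symmetry. *)

(* Defs.v *)
From Stdlib Require Import Reals ZArith List.
Import ListNotations.
Open Scope R_scope.

(** * The plane and its tessellation by cells *)

Definition point : Type := (R * R)%type.
Definition pset : Type := point -> Prop.

Definition isometry (t : point -> point) : Prop :=
  forall p q : point,
    dist_euc (fst (t p)) (snd (t p)) (fst (t q)) (snd (t q)) =
    dist_euc (fst p) (snd p) (fst q) (snd q).

(* [B] is the image of [A] under [t]. *)
Definition maps_onto (t : point -> point) (A B : pset) : Prop :=
  forall q, B q <-> exists p, A p /\ t p = q.

Definition translation (v : point) : point -> point :=
  fun p => (fst p + fst v, snd p + snd v).

Definition cell (i j : Z) : pset := fun p =>
  (IZR i <= fst p <= IZR i + 1) /\ (IZR j <= snd p <= IZR j + 1).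

Definition grid_isometry (t : point -> point) : Prop :=
  isometry t /\
  forall i j, exists i' j', maps_onto t (cell i j) (cell i' j').

Inductive strand : Type :=
| Warp (i : Z)
| Weft (j : Z).

Definition strand_set (s : strand) : pset := fun p =>
  match s with
  | Warp i => IZR i <= fst p <= IZR i + 1
  | Weft j => IZR j <= snd p <= IZR j + 1
  end.

Definition maps_strand (t : point -> point) (s s' : strand) : Prop :=
  maps_onto t (strand_set s) (strand_set s').

(** * Prefabrics and their symmetries *)

(* A prefabric is given by its design: [D i j = true] iff the cell
   [cell i j] is dark, i.e. the warp passes over the weft there. *)
Definition design : Type := Z -> Z -> bool.

(* [over D s s']: the strands [s] and [s'] cross, and [s] is on top. *)
Definition over (D : design) (s s' : strand) : Prop :=
  match s, s' with
  | Warp i, Weft j => D i j = true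
  | Weft j, Warp i => D i j = false
  | _, _ => False
  end.

Inductive side : Type :=
| side_e      (* side-preserving *)
| side_tau.   (* side-reversing: composed with the reflection in the plane *)

(* [symmetry D t r] is membership of the pair (t, r) in G_1. *)
Definition symmetry (D : design) (t : point -> point) (r : side) : Prop :=
  grid_isometry t /\
  forall s1 s2 s1' s2',
    maps_strand t s1 s1' -> maps_strand t s2 s2' ->
    (over D s1 s2 <->
     match r with
     | side_e => over D s1' s2'
     | side_tau => over D s2' s1'
     end).

(* The plane isometries underlying G_1.  No information is lost: (id, tau) is
   never a symmetry, so [t] determines [r]. *)
Definition G1 (D : design) (t : point -> point) : Prop :=
  exists r, symmetry D t r.

Definition H1 (D : design) (t : point -> point) : Prop :=
  symmetry D t side_e.

Definition periodic (D : design) : Prop :=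
  exists u v : point,
    fst u * snd v - snd u * fst v <> 0 /\
    G1 D (translation u) /\ G1 D (translation v).

Definition isonemal (D : design) : Prop :=
  periodic D /\
  forall s s', exists t r, symmetry D t r /\ maps_strand t s s'.

(* The strands can be split into two nonempty classes, one of which lies
   entirely over the other. *)
Definition falls_apart (D : design) : Prop :=
  exists A : strand -> Prop,
    (exists s, A s) /\ (exists s, ~ A s) /\
    forall i j,
      (A (Warp i) -> ~ A (Weft j) -> over D (Warp i) (Weft j)) /\
      (A (Weft j) -> ~ A (Warp i) -> over D (Weft j) (Warp i)).

Definition fabric (D : design) : Prop := ~ falls_apart D.

Definition along (D : design) (s : strand) (k : Z) : bool :=
  match s with
  | Warp i => D i k
  | Weft j => D k j
  end.

Definition period_along (D : design) (s : strand) (n : Z) : Prop :=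
  forall k, along D s (k + n)%Z = along D s k.

Definition has_order (D : design) (n : Z) : Prop :=
  (0 < n)%Z /\
  forall s, period_along D s n /\
    forall n', (0 < n' < n)%Z -> ~ period_along D s n'.

(** * Crystallographic types *)

Inductive wallpaper : Type := p2 | pg | pmm | pmg | pgg | cmm.

(* The coset representatives modulo the lattice Z^2, as in the International
   Tables: [(a, b, u, v)] stands for (x, y) |-> (a x + u, b y + v). *)
Definition general_positions (w : wallpaper) : list (R * R * R * R) :=
  match w with
  | p2 => [(1, 1, 0, 0); (-1, -1, 0, 0)]
  | pg => [(1, 1, 0, 0); (-1, 1, 0, 1/2)]
  | pmm => [(1, 1, 0, 0); (-1, -1, 0, 0); (-1, 1, 0, 0); (1, -1, 0, 0)]
  | pmg => [(1, 1, 0, 0); (-1, -1, 0, 0);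
            (-1, 1, 1/2, 0); (1, -1, 1/2, 0)]
  | pgg => [(1, 1, 0, 0); (-1, -1, 0, 0);
            (-1, 1, 1/2, 1/2); (1, -1, 1/2, 1/2)]
  | cmm => [(1, 1, 0, 0); (-1, -1, 0, 0); (-1, 1, 0, 0); (1, -1, 0, 0);
            (1, 1, 1/2, 1/2); (-1, -1, 1/2, 1/2);
            (-1, 1, 1/2, 1/2); (1, -1, 1/2, 1/2)]
  end.

Definition standard_group (w : wallpaper) (f : point -> point) : Prop :=
  exists a b u v (k l : Z),
    In (a, b, u, v) (general_positions w) /\
    forall x y, f (x, y) = (a * x + u + IZR k, b * y + v + IZR l).

Definition affine (phi : point -> point) : Prop :=
  exists a b c d e f,
    forall x y, phi (x, y) = (a * x + b * y + e, c * x + d * y + f).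

(* Two crystallographic groups have the same type when they are conjugate by
   an affine bijection of the plane; [psi] is the inverse of [phi]. *)
Definition has_type (Gamma : (point -> point) -> Prop) (w : wallpaper) : Prop :=
  exists phi psi : point -> point,
    affine phi /\
    (forall p, psi (phi p) = p) /\ (forall p, phi (psi p) = p) /\
    forall f, Gamma f <-> standard_group w (fun p => phi (f (psi p))).

(** * Species *)

Inductive species : Type := sp17 | sp19 | sp21 | sp25 | sp27 | sp29.

(* The types of G_1 and of H_1. *)
Definition roth_pair (n : species) : wallpaper * wallpaper :=
  match n with
  | sp17 => (pmg, p2)
  | sp19 => (pmg, pg)
  | sp21 => (pmg, pgg)
  | sp25 => (pmm, p2)
  | sp27 => (cmm, p2)
  | sp29 => (cmm, pgg)
  end.

(* Several of the 39 types share the same pair (G_1, H_1): 17-18 are pmg/p2,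
   19-20 pmg/pg, 21-24 pmg/pgg, 25-26 pmm/p2, 27-28 cmm/p2, 29-32 cmm/pgg.
   What separates them is how the stabilizer of a strand acts.  In the six
   types considered here it consists of side-preserving translations only; in
   the others it contains half-turns or side-reversing translations. *)
Definition strand_stabilizers_translational (D : design) : Prop :=
  forall s t r, symmetry D t r -> maps_strand t s s ->
    r = side_e /\ exists v, forall p, t p = translation v p.

Definition has_species (D : design) (n : species) : Prop :=
  (exists N, has_order D N /\ (4 < N)%Z) /\
  has_type (G1 D) (fst (roth_pair n)) /\
  has_type (H1 D) (snd (roth_pair n)) /\
  strand_stabilizers_translational D.

(** * Thick striping *)

Definition colouring : Type := strand -> nat.

Definition thick_striping (col : colouring) : Prop :=
  forall a,
    col (Warp (2 * a)) = col (Warp (2 * a + 1)) /\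
    col (Weft (2 * a)) = col (Weft (2 * a + 1)).

(* The warps and the wefts both use exactly the colours 0, ..., c - 1. *)
Definition uses_colours (col : colouring) (c : nat) : Prop :=
  (forall s, (col s < c)%nat) /\
  forall k, (k < c)%nat ->
    (exists i, col (Warp i) = k) /\ (exists j, col (Weft j) = k).

Definition colour_symmetry (col : colouring) (t : point -> point) : Prop :=
  forall k, exists k', forall s s',
    col s = k -> maps_strand t s s' -> col s' = k'.

Definition perfect (D : design) (col : colouring) : Prop :=
  forall t r, symmetry D t r -> colour_symmetry col t.

(* Redundancy of the block [2a, 2a+2] x [2b, 2b+2] of a thick striping. *)
Definition redundant_block (col : colouring) (a b : Z) : Prop :=
  col (Warp (2 * a)) = col (Weft (2 * b)).

(* [T] is the (c-1)/1 twill. *)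
Definition is_twill (c : nat) (T : design) : Prop :=
  exists t, grid_isometry t /\
    forall i j i' j', maps_onto t (cell i j) (cell i' j') ->
      (T i' j' = true <-> (Z.of_nat c | i - j)%Z).

Definition double (T : design) : design :=
  fun i j => T (i / 2)%Z (j / 2)%Z.

(* Darkening the cells of the redundant blocks gives the double of the
   (c-1)/1 twill. *)
Definition redundant_blocks_doubled_twill (col : colouring) (c : nat) : Prop :=
  exists T, is_twill c T /\
    forall i j, redundant_block col (i / 2) (j / 2) <-> double T i j = true.

(* Main.v *)
Require Import Defs.
From Stdlib Require Import Reals ZArith List Bool Lra Lia FunctionalExtensionality.
Import ListNotations.
Local Open Scope Z_scope.
Local Ltac Zify.zify_post_hook ::= Z.to_euclidean_division_equations.

(** Colour the strands of index [i], warps and wefts alike, by [i / 2] modulo [2m].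
    In the diagonal coordinates [u = x - y], [v = x + y] the isometries
    [(u, v) |-> (+-u + 4mk, +-v + 4l)] permute the colours.  For each species we pick a
    subgroup of this group that is transitive on strands and has the type required of
    [G_1], together with the homomorphism to signs whose kernel has the type required of
    [H_1], and a design whose symmetries are exactly that subgroup with these signs.

    If the signs do not force the design to be half dark (17, 25, 27), its rows [v = 0] and
    [v = 2] modulo 4 are dark and light and the odd rows carry one dark cell per period,
    whose position pins down the motion in [u].  Otherwise (19, 21, 29) this is done
    by rows in which half of each period is dark.

    By transitivity a period of one strand is a period of all, hence a translation
    symmetry of the design: the order is read off the lattice. *)

(** * Grid isometries *)

Definition sgn (b : bool) : Z := if b then -1 else 1.

Definition gmap (w n1 n2 : bool) (a b : Z) : point -> point := fun p =>
  if w then (IZR (sgn n1) * snd p + IZR a, IZR (sgn n2) * fst p + IZR b)%R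
  else (IZR (sgn n1) * fst p + IZR a, IZR (sgn n2) * snd p + IZR b)%R.

(* The interval [i, i + 1] is mapped by [x |-> sgn n * x + a] to the one starting at [act n a i]. *)
Definition act (n : bool) (a i : Z) : Z := if n then a - 1 - i else i + a.

Definition gstrand (w n1 n2 : bool) (a b : Z) (s : strand) : strand :=
  match s with
  | Warp i => if w then Weft (act n2 b i) else Warp (act n1 a i)
  | Weft j => if w then Warp (act n1 a j) else Weft (act n2 b j)
  end.

(* [(gcell1 w n1 a i j, gcell1 (negb w) n2 b i j)] is the image of cell [(i, j)]. *)
Definition gcell1 (w n : bool) (a i j : Z) : Z := act n a (if w then j else i).

(** * Isometries of the plane that preserve the cells *)

Lemma isometry_sqdist (t : point -> point) (p q : point) : isometry t ->
  ((fst (t p) - fst (t q)) ^ 2 + (snd (t p) - snd (t q)) ^ 2 =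
   (fst p - fst q) ^ 2 + (snd p - snd q) ^ 2)%R.
Proof.
  intros H. specialize (H p q). unfold dist_euc in H.
  apply sqrt_inj in H; try (apply Rplus_le_le_0_compat; apply Rle_0_sqr).
  unfold Rsqr in H. lra.
Qed.

(** A matrix with orthonormal columns is inverted by its transpose on both sides. With e the
    determinant, e^2 = 1 and the second column is e times the first one turned by a right angle. *)
Lemma orthonormal_coordinates (a b c d q1 q2 x y : R) :
  (a * a + c * c = 1 -> b * b + d * d = 1 -> a * b + c * d = 0 ->
   a * q1 + c * q2 = x -> b * q1 + d * q2 = y ->
   q1 = a * x + b * y /\ q2 = c * x + d * y)%R.
Proof.
  intros H1 H2 H3 Hx Hy.
  assert (HD : ((a * d - b * c) * (a * d - b * c) = 1)%R).
  { replace ((a * d - b * c) * (a * d - b * c))%R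
      with ((a * a + c * c) * (b * b + d * d) - (a * b + c * d) * (a * b + c * d))%R
      by ring. rewrite H1, H2, H3. ring. }
  set (e := (a * d - b * c)%R) in *.
  assert (Hb : (b = - e * c)%R).
  { unfold e. replace (- (a * d - b * c) * c)%R
      with (b * (a * a + c * c) - a * (a * b + c * d))%R by ring.
    rewrite H1, H3. ring. }
  assert (Hd : (d = e * a)%R).
  { unfold e. replace ((a * d - b * c) * a)%R
      with (d * (a * a + c * c) - c * (a * b + c * d))%R by ring.
    rewrite H1, H3. ring. }
  clearbody e. subst b d x y. split.
  - replace (a * (a * q1 + c * q2) + - e * c * (- e * c * q1 + e * a * q2))%R
      with (q1 * (a * a + (e * e) * (c * c)) + a * c * q2 * (1 - e * e))%R by ring.
    rewrite HD. replace (a * a + 1 * (c * c))%R with (a * a + c * c)%R by ring.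
    rewrite H1. ring.
  - replace (c * (a * q1 + c * q2) + e * a * (- e * c * q1 + e * a * q2))%R
      with (q2 * ((e * e) * (a * a) + c * c) + a * c * q1 * (1 - e * e))%R by ring.
    rewrite HD. replace (1 * (a * a) + c * c)%R with (a * a + c * c)%R by ring.
    rewrite H1. ring.
Qed.

(** Distances to the origin and to the two unit points determine, by polarization, the inner
    products of [t p - t o] with the images of the unit vectors, hence [t p]. *)
Lemma isometry_affine (t : point -> point) : isometry t ->
  exists a b c d e f : R,
    (a * a + c * c = 1 /\ b * b + d * d = 1 /\ a * b + c * d = 0 /\
     forall p, t p = (a * fst p + b * snd p + e, c * fst p + d * snd p + f))%R.
Proof.
  intros H.
  pose proof (fun p q => isometry_sqdist t p q H) as S.
  set (o := (0, 0)%R : point). set (p1 := (1, 0)%R : point). set (p2 := (0, 1)%R : point).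
  pose proof (S p1 o) as S1. pose proof (S p2 o) as S2. pose proof (S p1 p2) as S3.
  exists (fst (t p1) - fst (t o))%R, (fst (t p2) - fst (t o))%R,
         (snd (t p1) - snd (t o))%R, (snd (t p2) - snd (t o))%R,
         (fst (t o)), (snd (t o)).
  simpl in S1, S2, S3.
  split; [nra|]. split; [nra|]. split; [nra|].
  intros p. pose proof (S p o) as T0. pose proof (S p p1) as T1. pose proof (S p p2) as T2.
  simpl in T0, T1, T2.
  destruct (orthonormal_coordinates
    (fst (t p1) - fst (t o)) (fst (t p2) - fst (t o))
    (snd (t p1) - snd (t o)) (snd (t p2) - snd (t o))
    (fst (t p) - fst (t o)) (snd (t p) - snd (t o)) (fst p) (snd p)) as [A B];
    try nra.
  rewrite (surjective_pairing (t p)). f_equal; lra.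
Qed.

Lemma sqr_eq_1 (a : R) : (a * a = 1)%R -> exists n, a = IZR (sgn n).
Proof.
  intros H. assert (E : ((a - 1) * (a + 1) = 0)%R) by lra.
  apply Rmult_integral in E as [E | E]; [exists false | exists true]; simpl; lra.
Qed.

(** The corners of a unit cell stay in a unit cell, which bounds |a + b| and |a - b| by 1; with a^2
    + b^2 = 1 this forces ab = 0, so the linear part permutes the axes up to sign. *)
Lemma grid_isometry_gmap (t : point -> point) : grid_isometry t ->
  exists w n1 n2 a b, t = gmap w n1 n2 a b.
Proof.
  intros [H G]. destruct (isometry_affine t H) as (a & b & c & d & e & f & H1 & H2 & H3 & Ht).
  destruct (G 0 0) as (i & j & M).
  assert (C : forall x y : R, (0 <= x <= 1 -> 0 <= y <= 1 ->
    (IZR i <= a * x + b * y + e <= IZR i + 1) /\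
    (IZR j <= c * x + d * y + f <= IZR j + 1))%R).
  { intros x y Hx Hy. destruct (proj2 (M (t (x, y)))) as [P Q].
    - exists (x, y). split; [unfold cell; simpl; lra | reflexivity].
    - rewrite Ht in P, Q. simpl in P, Q. lra. }
  clear M G H.
  pose proof (C 0 0 ltac:(lra) ltac:(lra))%R as C00.
  pose proof (C 1 0 ltac:(lra) ltac:(lra))%R as C10.
  pose proof (C 0 1 ltac:(lra) ltac:(lra))%R as C01.
  pose proof (C 1 1 ltac:(lra) ltac:(lra))%R as C11.
  clear C.
  assert (R1 : (a * a + b * b = 1)%R).
  { destruct (orthonormal_coordinates a b c d 1 0 a b) as [A _]; lra. }
  assert (Hab : (a * b = 0)%R).
  { assert (-1 <= a + b <= 1)%R by lra. assert (-1 <= a - b <= 1)%R by lra. nra. }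
  apply Rmult_integral in Hab as [Ha | Hb].
  - subst a. assert (Hd : d = 0%R) by (assert (c * d = 0)%R by lra; nra). subst d.
    destruct (sqr_eq_1 c) as [n2 Hc]; [lra|]. destruct (sqr_eq_1 b) as [n1 Hb]; [lra|].
    (* A reflected coordinate sends 0 to the upper end of the image interval, hence [i + 1]. *)
    exists true, n1, n2, (if n1 then i + 1 else i), (if n2 then j + 1 else j).
    apply functional_extensionality. intros p. rewrite Ht. unfold gmap.
    subst b c. destruct n1, n2; simpl in *; rewrite ?plus_IZR; f_equal; lra.
  - subst b. assert (Hd : c = 0%R) by (assert (c * d = 0)%R by lra; nra). subst c.
    destruct (sqr_eq_1 a) as [n1 Ha]; [lra|]. destruct (sqr_eq_1 d) as [n2 Hd]; [lra|].
    exists false, n1, n2, (if n1 then i + 1 else i), (if n2 then j + 1 else j).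
    apply functional_extensionality. intros p. rewrite Ht. unfold gmap.
    subst a d. destruct n1, n2; simpl in *; rewrite ?plus_IZR; f_equal; lra.
Qed.

Lemma maps_onto_unique (t : point -> point) (A B B' : pset) :
  maps_onto t A B -> maps_onto t A B' -> forall q, B q <-> B' q.
Proof. intros H H' q. rewrite (H q), (H' q). reflexivity. Qed.

Lemma act_interval (n : bool) (a i : Z) (x r : R) :
  (x = IZR (sgn n) * r + IZR a)%R ->
  (IZR i <= r <= IZR i + 1 <-> IZR (act n a i) <= x <= IZR (act n a i) + 1)%R.
Proof.
  intros ->. unfold act, sgn. destruct n; rewrite ?minus_IZR, ?plus_IZR; lra.
Qed.

Lemma gmap_surj (w n1 n2 : bool) (a b : Z) (q : point) :
  exists p, gmap w n1 n2 a b p = q.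
Proof.
  exists (if w then (IZR (sgn n2) * (snd q - IZR b), IZR (sgn n1) * (fst q - IZR a))%R
     else (IZR (sgn n1) * (fst q - IZR a), IZR (sgn n2) * (snd q - IZR b))%R).
  destruct q as [x y]. unfold gmap. destruct w, n1, n2; simpl; f_equal; ring.
Qed.

Lemma maps_onto_gmap (w n1 n2 : bool) (a b : Z) (A B : pset) :
  (forall p, A p <-> B (gmap w n1 n2 a b p)) -> maps_onto (gmap w n1 n2 a b) A B.
Proof.
  intros H q. split.
  - intros Bq. destruct (gmap_surj w n1 n2 a b q) as [p <-]. exists p.
    rewrite H. auto.
  - intros (p & Ap & <-). apply H, Ap.
Qed.

Lemma strand_set_inj (s s' : strand) :
  (forall q, strand_set s q <-> strand_set s' q) -> s = s'.
Proof.
  intros H. destruct s as [i | i], s' as [j | j]; simpl in H.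
  - f_equal. pose proof (proj1 (H (IZR i, 0%R))) as P.
    pose proof (proj1 (H (IZR i + 1, 0)%R)) as Q. simpl in P, Q.
    assert (IZR i = IZR j) by lra. apply eq_IZR; assumption.
  - pose proof (proj1 (H (IZR i, IZR j + 2)%R)) as P. simpl in P. lra.
  - pose proof (proj1 (H (IZR j + 2, IZR i)%R)) as P. simpl in P. lra.
  - f_equal. pose proof (proj1 (H (0%R, IZR i))) as P.
    pose proof (proj1 (H (0, IZR i + 1)%R)) as Q. simpl in P, Q.
    assert (IZR i = IZR j) by lra. apply eq_IZR; assumption.
Qed.

Lemma cell_inj (i j i' j' : Z) :
  (forall q, cell i j q <-> cell i' j' q) -> i = i' /\ j = j'.
Proof.
  intros H. unfold cell in H. pose proof (proj1 (H (IZR i, IZR j))) as P.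
  pose proof (proj1 (H (IZR i + 1, IZR j + 1)%R)) as Q. simpl in P, Q.
  split; apply eq_IZR; lra.
Qed.

Lemma maps_strand_gmap (w n1 n2 : bool) (a b : Z) (s s' : strand) :
  maps_strand (gmap w n1 n2 a b) s s' <-> s' = gstrand w n1 n2 a b s.
Proof.
  assert (E : maps_strand (gmap w n1 n2 a b) s (gstrand w n1 n2 a b s)).
  { apply maps_onto_gmap. intros p.
    destruct s, w; simpl; apply act_interval; reflexivity. }
  split.
  - intros H. apply strand_set_inj. exact (maps_onto_unique _ _ _ _ H E).
  - intros ->. exact E.
Qed.

Lemma gmap_grid_isometry (w n1 n2 : bool) (a b : Z) : grid_isometry (gmap w n1 n2 a b).
Proof.
  split.
  - intros p q. unfold dist_euc, gmap. f_equal.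
    destruct w, n1, n2; simpl; unfold Rsqr; ring.
  - intros i j. exists (gcell1 w n1 a i j), (gcell1 (negb w) n2 b i j).
    apply maps_onto_gmap. intros p. unfold cell, gcell1, gmap.
    destruct w; simpl.
    + rewrite and_comm. apply Morphisms_Prop.and_iff_morphism; apply act_interval; reflexivity.
    + apply Morphisms_Prop.and_iff_morphism; apply act_interval; reflexivity.
Qed.

Definition reverses (r : side) : bool :=
  match r with side_e => false | side_tau => true end.

(** Exchanging warps and wefts swaps dark and light, and so does reversing the sides; the two
    effects cancel when both occur. *)
Lemma symmetry_gmap (D : design) (w n1 n2 : bool) (a b : Z) (r : side) :
  symmetry D (gmap w n1 n2 a b) r <->
  forall i j, D (gcell1 w n1 a i j) (gcell1 (negb w) n2 b i j) =
    xorb (D i j) (xorb w (reverses r)).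
Proof.
  split.
  - intros [_ H] i j.
    specialize (H (Warp i) (Weft j) _ _
      (proj2 (maps_strand_gmap w n1 n2 a b (Warp i) _) eq_refl)
      (proj2 (maps_strand_gmap w n1 n2 a b (Weft j) _) eq_refl)).
    unfold gcell1. destruct w, r; simpl in *;
      repeat match goal with |- context [D ?x ?y] => destruct (D x y) end;
      simpl; intuition congruence.
  - intros H. split; [apply gmap_grid_isometry|].
    intros s1 s2 s1' s2' H1 H2. apply maps_strand_gmap in H1, H2. subst s1' s2'.
    destruct s1 as [i | i], s2 as [j | j];
      [ destruct w, r; simpl; tauto | specialize (H i j)
      | specialize (H j i) | destruct w, r; simpl; tauto ];
      unfold gcell1 in H; destruct w, r; simpl in *; rewrite H;
      match goal with |- context [D ?x ?y] => destruct (D x y) end;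
      simpl; intuition congruence.
Qed.

(** * Designs with prescribed symmetries *)

(* [(u, v) |-> (sgn nU * u + 4 m k, sgn nV * v + 4 l)] where [u = x - y], [v = x + y]. *)
Definition diag_map (m : Z) (nU nV : bool) (k l : Z) : point -> point :=
  gmap (xorb nU nV) nV nV (2 * (m * k + l)) (2 * (l - m * k)).

(* The centre of cell [(i, j)] has [u = i - j] and [v = i + j + 1], so only the values
   of [F] at arguments with odd sum matter. *)
Definition weave (F : Z -> Z -> bool) : design := fun i j => F (i - j) (i + j + 1).

(** The group chosen for G_1. With U = u / 4m and V = v / 4 its elements are (+-U + k, +-V + l): a
    pmg group with mirrors U = const and glides along U for 17, 19, 21, a pmm group for 25, and a
    cmm group for 27, 29. *)
Definition admissible (n : species) (nU nV : bool) (k l : Z) : Prop :=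
  match n with
  | sp17 | sp19 | sp21 => k mod 2 = if xorb nU nV then 1 else 0
  | sp25 => k mod 2 = 0
  | sp27 | sp29 => k mod 2 = 0 /\ (k / 2 + l) mod 2 = 0
  end.

(* Whether the colour of cells (dark or light) is exchanged; side reversal differs from
   this by the exchange of warps and wefts, see [symmetry_iff]. *)
Definition flips (n : species) (nV : bool) (l : Z) : bool :=
  match n with
  | sp17 | sp25 | sp27 => false
  | sp19 => nV
  | sp21 | sp29 => l mod 2 =? 1
  end.

(** The first two fields make the admissible maps, with their flips, exactly the motions that act on
    u and v separately and preserve [F] up to complement; motions of the grid have a + b even. The
    last two link neighbouring warps, so that the prefabric does not fall apart. *)
Record realizes (m : Z) (n : species) (F : Z -> Z -> bool) : Prop := {
  rz_invariant : forall nU nV k l u v,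
    admissible n nU nV k l -> (u + v) mod 2 = 1 ->
    F (sgn nU * u + 4 * m * k) (sgn nV * v + 4 * l) = xorb (flips n nV l) (F u v);
  rz_exact : forall nU nV a b c, (a + b) mod 2 = 0 ->
    (forall u v, (u + v) mod 2 = 1 ->
      F (sgn nU * u + a) (sgn nV * v + b) = xorb c (F u v)) ->
    exists k l, a = 4 * m * k /\ b = 4 * l /\ admissible n nU nV k l /\ c = flips n nV l;
  rz_rise : forall i, exists j, weave F i j = false /\ weave F (i + 1) j = true;
  rz_fall : forall i, exists j, weave F i j = true /\ weave F (i + 1) j = false
}.

(** * The symmetry group of a design that realizes a species *)

Lemma gcell_diff (w n : bool) (a b i j : Z) :
  gcell1 w n a i j - gcell1 (negb w) n b i j = sgn (xorb w n) * (i - j) + (a - b).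
Proof. destruct w, n; unfold gcell1, act, sgn; cbn [xorb negb]; lia. Qed.

Lemma gcell_sum (w n : bool) (a b i j : Z) :
  gcell1 w n a i j + gcell1 (negb w) n b i j + 1 = sgn n * (i + j + 1) + (a + b).
Proof. destruct w, n; unfold gcell1, act, sgn; cbn [xorb negb]; lia. Qed.

Lemma diagonal_coordinates (u v : Z) : (u + v) mod 2 = 1 ->
  exists i j, u = i - j /\ v = i + j + 1.
Proof.
  intros H. exists ((u + v) / 2), ((u + v) / 2 - u). split; lia.
Qed.

(** With equal signs on both axes u and v are not exchanged: v gets the sign of [n], and u that of
    [xorb w n]. *)
Lemma symmetry_diag (F : Z -> Z -> bool) (w n : bool) (a b : Z) (r : side) :
  symmetry (weave F) (gmap w n n a b) r <->
  forall u v, (u + v) mod 2 = 1 ->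
    F (sgn (xorb w n) * u + (a - b)) (sgn n * v + (a + b)) =
    xorb (xorb w (reverses r)) (F u v).
Proof.
  rewrite symmetry_gmap. unfold weave. split.
  - intros H u v Huv. destruct (diagonal_coordinates u v Huv) as (i & j & -> & ->).
    specialize (H i j). rewrite gcell_diff, gcell_sum in H. rewrite H. apply xorb_comm.
  - intros H i j. rewrite gcell_diff, gcell_sum, H by lia. apply xorb_comm.
Qed.

Lemma admissible_diagonal_period (n : species) : admissible n false false 0 2.
Proof. destruct n; simpl; lia. Qed.

Lemma xorb_involutive (a b : bool) : xorb (xorb a b) b = a.
Proof. destruct a, b; reflexivity. Qed.

(* Conjugating the translation by (4, 4) by an axis reflection or a quarter turn
   would give a translation by (4, -4), which [rz_exact] rules out. *)
Lemma no_axis_symmetry (m : Z) (n : species) (F : Z -> Z -> bool) (w n1 : bool)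
  (a b : Z) (r : side) : 2 <= m -> realizes m n F ->
  ~ symmetry (weave F) (gmap w n1 (negb n1) a b) r.
Proof.
  intros Hm HF H. rewrite symmetry_gmap in H.
  assert (P : forall i j, weave F (i + 4) (j + 4) = weave F i j).
  { intros i j. pose proof (rz_invariant _ _ _ HF _ _ _ _ (i - j) (i + j + 1)
      (admissible_diagonal_period n) ltac:(lia)) as I.
    unfold weave. simpl sgn in I.
    replace (i + 4 - (j + 4)) with (1 * (i - j) + 4 * m * 0) by lia.
    replace (i + 4 + (j + 4) + 1) with (1 * (i + j + 1) + 4 * 2) by lia.
    rewrite I. destruct n; reflexivity. }
  assert (Q : forall i j, weave F (i + 4) (j - 4) = weave F i j).
  { intros i j.
    set (x0 := if n1 then a - 1 - (i + 4) else i - a).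
    set (y0 := if n1 then j - 4 - b else b - 1 - j).
    set (i0 := if w then y0 else x0). set (j0 := if w then x0 else y0).
    pose proof (H i0 j0) as H0. pose proof (H (i0 + 4) (j0 + 4)) as H4.
    rewrite P, <- H0 in H4. unfold gcell1, act in H4.
    destruct n1; [symmetry|]; (etransitivity; [etransitivity; [|exact H4]|]);
      subst i0 j0 x0 y0; f_equal; destruct w; cbn [negb]; ring. }
  (* The translation by (4, -4) is (u, v) |-> (u + 8, v). Exactness would give 8 = 4mk with k even
     and nonzero, but then |4mk| >= 16. *)
  destruct (rz_exact _ _ _ HF false false 8 0 false) as (k & l & Hk & _ & A & _).
  - reflexivity.
  - intros u v Huv. destruct (diagonal_coordinates u v Huv) as (i & j & -> & ->).
    specialize (Q i j). unfold weave in Q. simpl sgn. rewrite xorb_false_l, <- Q.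
    f_equal; lia.
  - assert (E : k mod 2 = 0) by (destruct n; simpl in A; tauto).
    assert (k <> 0) by nia. assert (2 <= Z.abs k) by lia. nia.
Qed.

(** A grid isometry either exchanges u and v, which is excluded above, or acts on them separately,
    and then [rz_exact] applies. Warps and wefts are exchanged when exactly one of u, v changes
    sign, whence [xorb nU nV] in the side. *)
Lemma symmetry_iff (m : Z) (n : species) (F : Z -> Z -> bool)
  (t : point -> point) (r : side) : 2 <= m -> realizes m n F ->
  (symmetry (weave F) t r <->
   exists nU nV k l, admissible n nU nV k l /\ t = diag_map m nU nV k l /\
     reverses r = xorb (xorb nU nV) (flips n nV l)).
Proof.
  intros Hm HF. split.
  - intros H. destruct (grid_isometry_gmap t (proj1 H)) as (w & n1 & n2 & a & b & ->).
    destruct (bool_dec n1 n2) as [<- | N].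
    2: { exfalso. replace n2 with (negb n1) in H by (destruct n1, n2; tauto).
         revert H. apply (no_axis_symmetry m n); assumption. }
    rewrite symmetry_diag in H. apply (rz_exact _ _ _ HF) in H; [|lia].
    destruct H as (k & l & Ha & Hb & A & C).
    exists (xorb w n1), n1, k, l. split; [exact A|]. split.
    + unfold diag_map. rewrite xorb_involutive. f_equal; lia.
    + rewrite xorb_involutive, <- C. destruct w, r; reflexivity.
  - intros (nU & nV & k & l & A & -> & Hr). unfold diag_map.
    rewrite symmetry_diag. intros u v Huv. rewrite xorb_involutive, Hr.
    replace (2 * (m * k + l) - 2 * (l - m * k)) with (4 * m * k) by ring.
    replace (2 * (m * k + l) + 2 * (l - m * k)) with (4 * l) by ring.
    rewrite (rz_invariant _ _ _ HF) by assumption.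
    destruct nU, nV, (flips n _ l), (F u v); reflexivity.
Qed.

Lemma diag_map_coordinates (m : Z) (nU nV : bool) (k l : Z) (p : point) :
  (fst (diag_map m nU nV k l p) - snd (diag_map m nU nV k l p) =
     IZR (sgn nU) * (fst p - snd p) + 4 * IZR m * IZR k)%R /\
  (fst (diag_map m nU nV k l p) + snd (diag_map m nU nV k l p) =
     IZR (sgn nV) * (fst p + snd p) + 4 * IZR l)%R.
Proof.
  unfold diag_map, gmap.
  destruct nU, nV; cbn [xorb fst snd sgn];
    rewrite !mult_IZR, plus_IZR, minus_IZR, !mult_IZR; lra.
Qed.

(** * Periodicity and transitivity on strands *)

Lemma symmetry_exists (m : Z) (n : species) (F : Z -> Z -> bool) (nU nV : bool) (k l : Z) :
  2 <= m -> realizes m n F -> admissible n nU nV k l ->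
  exists r, symmetry (weave F) (diag_map m nU nV k l) r.
Proof.
  intros Hm HF A.
  exists (if xorb (xorb nU nV) (flips n nV l) then side_tau else side_e).
  apply (symmetry_iff m n); auto. exists nU, nV, k, l. repeat split; auto.
  destruct xorb; reflexivity.
Qed.

Lemma translation_diag_map (m k l : Z) :
  translation (IZR (2 * (m * k + l)), IZR (2 * (l - m * k))) = diag_map m false false k l.
Proof.
  apply functional_extensionality. intros p. unfold translation, diag_map, gmap.
  simpl. f_equal; lra.
Qed.

(* [e = 1] moves wefts and [e = -1] moves warps by [2 * b]. *)
Lemma admissible_transitive (m : Z) (n : species) : exists k0, forall (nV : bool) (b e : Z),
  (e = 1 \/ e = -1) ->
  admissible n nV nV (2 * b) (b + e * m * (2 * b)) /\
  admissible n (negb nV) nV (k0 + 2 * b) (b + e * m * (k0 + 2 * b)).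
Proof.
  (* For 17, 19 and 21 the maps that exchange warps and wefts have k odd. *)
  exists (match n with sp17 | sp19 | sp21 => 1 | _ => 0 end).
  intros nV b e [-> | ->]; destruct n, nV; unfold admissible;
    cbn [xorb negb]; repeat split; lia.
Qed.

Lemma isonemal_weave (m : Z) (n : species) (F : Z -> Z -> bool) :
  2 <= m -> realizes m n F -> isonemal (weave F).
Proof.
  intros Hm HF. split.
  (* The translations with k = 0, l = 2 and with k = 4, l = 0 are admissible for every species. *)
  - exists (IZR (2 * (m * 0 + 2)), IZR (2 * (2 - m * 0))).
    exists (IZR (2 * (m * 4 + 0)), IZR (2 * (0 - m * 4))).
    rewrite !translation_diag_map. split; [|split].
    + cbn [fst snd]. rewrite <- !mult_IZR, <- minus_IZR. apply not_0_IZR. nia.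
    + apply (symmetry_exists m n); auto. apply admissible_diagonal_period.
    + apply (symmetry_exists m n); auto. destruct n; simpl; lia.
  - destruct (admissible_transitive m n) as [k0 A].
    assert (S : forall s s', exists nU nV k l, admissible n nU nV k l /\
      s' = gstrand (xorb nU nV) nV nV (2 * (m * k + l)) (2 * (l - m * k)) s).
    { intros s s'. set (i := match s with Warp i | Weft i => i end).
      set (j := match s' with Warp j | Weft j => j end).
      (* Index i reaches j by the translation by 2b if i + j is even, and by the reflection i |-> 2b
         - 1 - i if it is odd. *)
      set (nV := (i + j) mod 2 =? 1).
      set (b := (if nV then i + j + 1 else j - i) / 2).
      assert (B : act nV (2 * b) i = j).
      { unfold b, nV, act. destruct (Z.eqb_spec ((i + j) mod 2) 1); lia. }
      (* The shift is 2(mk + l) for images that are warps and 2(l - mk) for wefts; [e] makes the one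
         for the target equal to 2b. *)
      set (e := match s' with Warp _ => -1 | Weft _ => 1 end).
      destruct (A nV b e) as [A1 A2]; [destruct s'; simpl in e; unfold e; auto|].
      destruct s as [x | x], s' as [y | y]; subst i j e; cbn iota beta in B.
      - exists nV, nV, (2 * b), (b + -1 * m * (2 * b)). split; [exact A1|].
        rewrite xorb_nilpotent. cbn [gstrand]. rewrite <- B. f_equal. f_equal. ring.
      - exists (negb nV), nV, (k0 + 2 * b), (b + 1 * m * (k0 + 2 * b)). split; [exact A2|].
        replace (xorb (negb nV) nV) with true by (destruct nV; reflexivity).
        cbn [gstrand]. rewrite <- B. f_equal. f_equal. ring.
      - exists (negb nV), nV, (k0 + 2 * b), (b + -1 * m * (k0 + 2 * b)). split; [exact A2|].
        replace (xorb (negb nV) nV) with true by (destruct nV; reflexivity).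
        cbn [gstrand]. rewrite <- B. f_equal. f_equal. ring.
      - exists nV, nV, (2 * b), (b + 1 * m * (2 * b)). split; [exact A1|].
        rewrite xorb_nilpotent. cbn [gstrand]. rewrite <- B. f_equal. f_equal. ring. }
    intros s s'. destruct (S s s') as (nU & nV & k & l & Ad & E).
    destruct (symmetry_exists m n F nU nV k l Hm HF Ad) as [r Hr].
    exists (diag_map m nU nV k l), r. split; [exact Hr|].
    apply maps_strand_gmap. exact E.
Qed.

(** * The order of the design *)

Lemma along_gstrand (D : design) (w n1 n2 : bool) (a b : Z) (r : side) (s : strand) :
  symmetry D (gmap w n1 n2 a b) r -> exists n c f, forall k,
    along D (gstrand w n1 n2 a b s) (act n c k) = xorb (along D s k) f.
Proof.
  intros H. rewrite symmetry_gmap in H.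
  destruct s as [i | j], w; simpl;
    [exists n1, a | exists n2, b | exists n2, b | exists n1, a];
    eexists; intros k;
    [exact (H i k) | exact (H i k) | exact (H k j) | exact (H k j)].
Qed.

Lemma period_along_symmetry (D : design) (t : point -> point) (r : side)
  (s s' : strand) (n : Z) :
  symmetry D t r -> maps_strand t s s' -> period_along D s n -> period_along D s' n.
Proof.
  intros H M P. destruct (grid_isometry_gmap t (proj1 H)) as (w & n1 & n2 & a & b & ->).
  apply maps_strand_gmap in M. subst s'.
  destruct (along_gstrand D w n1 n2 a b r s H) as (e & c & f & E).
  intros k. destruct e; unfold act in E.
  - pose proof (E (c - 1 - (k + n))) as E1. pose proof (E (c - 1 - (k + n) + n)) as E2.
    rewrite P, <- E1 in E2.
    replace (c - 1 - (c - 1 - (k + n) + n)) with k in E2 by ring.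
    replace (c - 1 - (c - 1 - (k + n))) with (k + n) in E2 by ring. congruence.
  - pose proof (E (k - c)) as E1. pose proof (E (k - c + n)) as E2.
    rewrite P, <- E1 in E2.
    replace (k - c + n + c) with (k + n) in E2 by ring.
    replace (k - c + c) with k in E2 by ring. congruence.
Qed.

Lemma order_weave (m : Z) (n : species) (F : Z -> Z -> bool) :
  2 <= m -> realizes m n F -> exists N, has_order (weave F) N /\ 4 < N.
Proof.
  (* A translation along a strand has l = +-mk and length 4m|k|; [K] is the least positive k for
     which it is admissible. *)
  intros Hm HF. set (K := match n with sp27 | sp29 => 4 | _ => 2 end).
  assert (HK : 0 < K) by (destruct n; reflexivity).
  exists (4 * m * K). split; [split; [nia|] | nia].
  intros s. split.
  - assert (P : forall e u v, (e = 1 \/ e = -1) -> (u + v) mod 2 = 1 ->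
      F (u + e * (4 * m * K)) (v + 4 * m * K) = F u v).
    { intros e u v He Huv.
      assert (A : admissible n false false (e * K) (m * K)).
      { unfold K; destruct n; unfold admissible; cbn [xorb]; destruct He as [-> | ->]; lia. }
      pose proof (rz_invariant _ _ _ HF _ _ _ _ u v A Huv) as I. simpl sgn in I.
      replace (1 * u + 4 * m * (e * K)) with (u + e * (4 * m * K)) in I by ring.
      replace (1 * v + 4 * (m * K)) with (v + 4 * m * K) in I by ring.
      rewrite I. replace (flips n false (m * K)) with false; [reflexivity|].
      unfold K; destruct n; unfold flips; symmetry; try reflexivity; apply Z.eqb_neq; lia. }
    intros k. destruct s as [i | j]; unfold along, weave.
    + rewrite <- (P (-1) (i - k) (i + k + 1)) by lia. f_equal; ring.
    + rewrite <- (P 1 (k - j) (k + j + 1)) by lia. f_equal; ring.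
  - intros n' Hn' P.
    assert (W : forall i, period_along (weave F) (Warp i) n').
    { intros i. destruct (proj2 (isonemal_weave m n F Hm HF) s (Warp i)) as (t & r & St & M).
      exact (period_along_symmetry _ _ _ _ _ _ St M P). }
    (* A common period n' of all warps is the translation (u, v) |-> (u - n', v + n'). *)
    destruct (rz_exact _ _ _ HF false false (- n') n' false) as (k & l & Hk & Hl & A & _).
    + lia.
    + intros u v Huv. destruct (diagonal_coordinates u v Huv) as (i & j & -> & ->).
      specialize (W i j). unfold along, weave in W. simpl sgn.
      rewrite xorb_false_l, <- W. f_equal; ring.
    + assert (L : l = - (m * k)) by lia. subst l.
      assert (D : exists q, k = K * q).
      { assert (Hk2 : k mod 2 = 0) by (destruct n; simpl in A; tauto).
        assert (E : k = 2 * (k / 2)) by lia. unfold admissible in A.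
        set (h := k / 2) in *. clearbody h. subst k.
        destruct n; unfold K; try (exists h; lia); exists (h / 2); lia. }
      destruct D as [q ->]. rewrite Z.mul_assoc in Hk.
      assert (0 < 4 * m * K) by nia. set (X := 4 * m * K) in *.
      clearbody X. clear - Hn' Hk H. destruct (Z.le_gt_cases 0 q); nia.
Qed.

(** * Connectedness and strand stabilizers *)

(** If the class [A] lies over its complement, a strand that passes over a member of [A] is in [A].
    A rise carries membership from warp i over a weft to warp i + 1, a fall carries it back, so all
    warps and then all wefts are in [A]. Double negations avoid deciding membership. *)
Lemma fabric_weave (m : Z) (n : species) (F : Z -> Z -> bool) :
  2 <= m -> realizes m n F -> fabric (weave F).
Proof.
  intros Hm HF (A & [s As] & [s' As'] & H). unfold over in H.
  set (D := weave F) in *.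
  assert (In : forall i j, A (Warp i) -> D i j = false -> ~ ~ A (Weft j)).
  { intros i j Ai Dij Aj. destruct (H i j) as [H1 _]. rewrite (H1 Ai Aj) in Dij. discriminate. }
  assert (Out : forall i j, A (Weft j) -> D i j = true -> ~ ~ A (Warp i)).
  { intros i j Aj Dij Ai. destruct (H i j) as [_ H1]. rewrite (H1 Aj Ai) in Dij. discriminate. }
  assert (Up : forall i, ~ ~ A (Warp i) -> ~ ~ A (Warp (i + 1))).
  { intros i Ai N. apply Ai. clear Ai. intros Ai.
    destruct (rz_rise _ _ _ HF i) as (j & D0 & D1).
    apply (In i j Ai D0). intros Aj. exact (Out _ _ Aj D1 N). }
  assert (Down : forall i, ~ ~ A (Warp (i + 1)) -> ~ ~ A (Warp i)).
  { intros i Ai N. apply Ai. clear Ai. intros Ai.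
    destruct (rz_fall _ _ _ HF i) as (j & D0 & D1).
    apply (In _ j Ai D1). intros Aj. exact (Out _ _ Aj D0 N). }
  assert (All : forall i i', ~ ~ A (Warp i) -> ~ ~ A (Warp i')).
  { intros i i' Ai. replace i' with (i + (i' - i)) by ring.
    generalize (i' - i). apply Z.bi_induction.
    - intros x y ->. reflexivity.
    - rewrite Z.add_0_r. exact Ai.
    - intros x. replace (i + Z.succ x) with (i + x + 1) by lia. split; auto. }
  (* Each weft is the image of warp 0, which has light and dark cells. *)
  assert (Mix : forall j c, exists i, D i j = c).
  { intros j c.
    destruct (proj2 (isonemal_weave m n F Hm HF) (Warp 0) (Weft j)) as (t & r & St & M).
    destruct (grid_isometry_gmap t (proj1 St)) as (w & n1 & n2 & a & b & ->).
    apply maps_strand_gmap in M.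
    destruct (along_gstrand _ _ _ _ _ _ _ (Warp 0) St) as (e & d & f & E).
    rewrite <- M in E. simpl in E.
    destruct (rz_rise _ _ _ HF 0) as (j0 & D0 & _).
    destruct (rz_fall _ _ _ HF 0) as (j1 & D1 & _).
    destruct (bool_dec c f) as [-> | N].
    - exists (act e d j0). unfold D. rewrite E, D0. reflexivity.
    - exists (act e d j1). unfold D. rewrite E, D1. destruct c, f; tauto. }
  assert (Any : exists i, ~ ~ A (Warp i)).
  { destruct s as [i | j]; [exists i; tauto|].
    destruct (Mix j true) as [i Di]. exists i. exact (Out i j As Di). }
  destruct Any as [i Ai]. destruct s' as [i' | j'].
  - exact (All i i' Ai As').
  - destruct (Mix j' false) as [i' Di']. apply (All i i' Ai). intros Ai'.
    exact (In i' j' Ai' Di' As').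
Qed.

(** The translation parts of the axes are even, so a reversed strand index i would solve an even
    number minus 1 equals 2i, which is impossible. A translation that fixes a strand has l = +-mk
    with k even, so l is even and no flip occurs. *)
Lemma stabilizers_weave (m : Z) (n : species) (F : Z -> Z -> bool) :
  2 <= m -> realizes m n F -> strand_stabilizers_translational (weave F).
Proof.
  intros Hm HF s t r H M. apply (symmetry_iff m n) in H; auto.
  destruct H as (nU & nV & k & l & A & -> & Hr).
  unfold diag_map in M. apply maps_strand_gmap in M.
  pose proof (f_equal (fun s => match s with Warp i | Weft i => i end) M) as E.
  assert (L : nU = false /\ nV = false /\ (l = m * k \/ l = - (m * k))).
  { destruct nU, nV, s; try discriminate M; unfold gstrand, act in E; cbn [xorb] in E; lia. }
  destruct L as (-> & -> & L). clear E M. split.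
  - replace (flips n false l) with false in Hr;
      [destruct r; [reflexivity | discriminate Hr]|].
    assert (E : k = 2 * (k / 2)) by (destruct n; simpl in A; lia).
    rewrite E in L. set (h := k / 2) in *. clearbody h.
    destruct n; unfold flips; symmetry; try reflexivity; apply Z.eqb_neq; lia.
  - eexists. intros p. rewrite <- translation_diag_map. reflexivity.
Qed.

(** * Crystallographic types *)

(** The linear change of the coordinates U = u / 4m, V = v / 4 conjugates (+-U + k, +-V + l) to an
    element of a standard group. *)
Definition intertwines (a11 a12 a21 a22 : R) (nU nV : bool) (k l : Z)
  (a b u v : R) (k' l' : Z) : Prop := (forall U V : R,
  a11 * (IZR (sgn nU) * U + IZR k) + a12 * (IZR (sgn nV) * V + IZR l) =
    a * (a11 * U + a12 * V) + u + IZR k' /\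
  a21 * (IZR (sgn nU) * U + IZR k) + a22 * (IZR (sgn nV) * V + IZR l) =
    b * (a21 * U + a22 * V) + v + IZR l')%R.

Lemma has_type_diag (m : Z) (Gamma : (point -> point) -> Prop)
  (P : bool -> bool -> Z -> Z -> Prop) (w : wallpaper) (a11 a12 a21 a22 : R) :
  m <> 0 -> (a11 * a22 - a12 * a21 <> 0)%R ->
  (forall f, Gamma f <-> exists nU nV k l, P nU nV k l /\ f = diag_map m nU nV k l) ->
  (forall nU nV k l, P nU nV k l -> exists a b u v k' l',
    In (a, b, u, v) (general_positions w) /\
    intertwines a11 a12 a21 a22 nU nV k l a b u v k' l') ->
  (forall a b u v k' l', In (a, b, u, v) (general_positions w) ->
    exists nU nV k l, P nU nV k l /\
      intertwines a11 a12 a21 a22 nU nV k l a b u v k' l') ->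
  has_type Gamma w.
Proof.
  intros Hm Hd HG Hto Hfrom.
  assert (Hm' : IZR m <> 0%R) by (apply not_0_IZR; exact Hm).
  set (cU := fun p : point => ((fst p - snd p) / (4 * IZR m))%R).
  set (cV := fun p : point => ((fst p + snd p) / 4)%R).
  set (phi := fun p => (a11 * cU p + a12 * cV p, a21 * cU p + a22 * cV p)%R : point).
  set (det := (a11 * a22 - a12 * a21)%R) in *.
  (* The inverse matrix recovers U and V, and then x = 2mU + 2V, y = 2V - 2mU. *)
  set (psi := fun q : point =>
    let U := ((a22 * fst q - a12 * snd q) / det)%R in
    let V := ((a11 * snd q - a21 * fst q) / det)%R in
    (2 * IZR m * U + 2 * V, 2 * V - 2 * IZR m * U)%R : point).
  assert (psiK : forall p, psi (phi p) = p).
  { intros [x y]. unfold psi, phi, cU, cV. simpl. unfold det in *.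
    f_equal; field; repeat split; assumption. }
  assert (phiK : forall p, phi (psi p) = p).
  { intros [x y]. unfold psi, phi, cU, cV. simpl. unfold det in *.
    f_equal; field; repeat split; assumption. }
  assert (act_phi : forall nU nV k l a b u v k' l' p,
    intertwines a11 a12 a21 a22 nU nV k l a b u v k' l' ->
    phi (diag_map m nU nV k l p) =
      (a * fst (phi p) + u + IZR k', b * snd (phi p) + v + IZR l')%R).
  { intros nU nV k l a b u v k' l' p HI.
    assert (EU : (cU (diag_map m nU nV k l p) = IZR (sgn nU) * cU p + IZR k)%R).
    { unfold cU. rewrite (proj1 (diag_map_coordinates m nU nV k l p)). field. exact Hm'. }
    assert (EV : (cV (diag_map m nU nV k l p) = IZR (sgn nV) * cV p + IZR l)%R).
    { unfold cV. rewrite (proj2 (diag_map_coordinates m nU nV k l p)). field. }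
    destruct (HI (cU p) (cV p)) as [E1 E2].
    unfold phi at 1. rewrite EU, EV, E1, E2. reflexivity. }
  exists phi, psi. split; [|split; [exact psiK | split; [exact phiK|]]].
  - exists (a11 / (4 * IZR m) + a12 / 4)%R, (a12 / 4 - a11 / (4 * IZR m))%R,
      (a21 / (4 * IZR m) + a22 / 4)%R, (a22 / 4 - a21 / (4 * IZR m))%R, 0%R, 0%R.
    intros x y. unfold phi, cU, cV. simpl. f_equal; field; assumption.
  - intros f. rewrite HG. split.
    + intros (nU & nV & k & l & HP & ->).
      destruct (Hto nU nV k l HP) as (a & b & u & v & k' & l' & Hin & HI).
      exists a, b, u, v, k', l'. split; [exact Hin|]. intros x y.
      rewrite (act_phi _ _ _ _ _ _ _ _ _ _ _ HI), phiK. reflexivity.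
    + intros (a & b & u & v & k' & l' & Hin & Hf).
      destruct (Hfrom a b u v k' l' Hin) as (nU & nV & k & l & HP & HI).
      exists nU, nV, k, l. split; [exact HP|].
      apply functional_extensionality. intros p.
      rewrite <- (psiK (f p)), <- (psiK (diag_map m nU nV k l p)). f_equal.
      rewrite (act_phi _ _ _ _ _ _ _ _ _ _ _ HI), <- Hf, <- surjective_pairing, psiK.
      reflexivity.
Qed.

Ltac intertwine :=
  intros ? ?; unfold sgn; cbn [xorb]; rewrite ?plus_IZR, ?mult_IZR, ?plus_IZR; split; lra.

Ltac position a b u v k l :=
  exists a, b, u, v, k, l; split; [simpl; auto 10 | intertwine].

Ltac positions H :=
  simpl in H; repeat destruct H as [H | H]; try contradiction;
  injection H as <- <- <- <-.

Lemma parity (k : Z) (b : Z) : k mod 2 = b -> exists h, k = 2 * h + b.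
Proof. intros H. exists (k / 2). lia. Qed.

Lemma centred_to (nU nV : bool) (k l : Z) : k mod 2 = 0 /\ (k / 2 + l) mod 2 = 0 ->
  exists a b u v k' l', In (a, b, u, v) (general_positions cmm) /\
    intertwines (1/4) 0 0 (1/2) nU nV k l a b u v k' l'.
Proof.
  intros A.
  (* In the conventional cell of size 4 by 2, (k, l) is a corner if c = 0 and a centre if c = 1. *)
  assert (B : exists h h' c, (c = 0 \/ c = 1) /\ k = 4 * h + 2 * c /\ l = 2 * h' + c).
  { exists (k / 4), (l / 2), (l mod 2). lia. }
  destruct B as (h & h' & c & Hc & -> & ->).
  exists (IZR (sgn nU)), (IZR (sgn nV)), (IZR c / 2)%R, (IZR c / 2)%R, h, h'.
  split; [|intertwine].
  destruct Hc as [-> | ->], nU, nV; simpl;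
    replace (0 / 2)%R with 0%R by lra; auto 10.
Qed.

Lemma centred_from (a b u v : R) (k l : Z) : In (a, b, u, v) (general_positions cmm) ->
  exists nU nV k' l', (k' mod 2 = 0 /\ (k' / 2 + l') mod 2 = 0) /\
    intertwines (1/4) 0 0 (1/2) nU nV k' l' a b u v k l.
Proof.
  intros H; positions H;
    [ exists false, false, (4 * k), (2 * l) | exists true, true, (4 * k), (2 * l)
    | exists true, false, (4 * k), (2 * l) | exists false, true, (4 * k), (2 * l)
    | exists false, false, (4 * k + 2), (2 * l + 1)
    | exists true, true, (4 * k + 2), (2 * l + 1)
    | exists true, false, (4 * k + 2), (2 * l + 1)
    | exists false, true, (4 * k + 2), (2 * l + 1) ];
    (split; [lia | intertwine]).
Qed.

(** The conventional cell of the lattice of pairs (k, l) is 2 by 1 in the rectangular cases and 4 by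
    2 in the centred ones; the matrix scales it to the unit square. *)
Lemma has_type_G1 (m : Z) (n : species) (Gamma : (point -> point) -> Prop) : m <> 0 ->
  (forall f, Gamma f <->
     exists nU nV k l, admissible n nU nV k l /\ f = diag_map m nU nV k l) ->
  has_type Gamma (fst (roth_pair n)).
Proof.
  intros Hm HG.
  destruct n; cbn [roth_pair fst].
  1-3: apply (has_type_diag m Gamma _ _ (1/2) 0 0 1 Hm ltac:(lra) HG);
    [ intros nU nV k l A; apply parity in A as [h ->];
      destruct nU, nV; cbn [xorb];
      [ position (-1)%R (-1)%R 0%R 0%R h l | position (-1)%R 1%R (1/2)%R 0%R h l
      | position 1%R (-1)%R (1/2)%R 0%R h l | position 1%R 1%R 0%R 0%R h l ]
    | intros a b u v k l H; positions H;
      [ exists false, false, (2 * k), l | exists true, true, (2 * k), l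
      | exists true, false, (2 * k + 1), l | exists false, true, (2 * k + 1), l ];
      (split; [unfold admissible; cbn [xorb]; lia | intertwine]) ].
  - apply (has_type_diag m Gamma _ _ (1/2) 0 0 1 Hm ltac:(lra) HG).
    + intros nU nV k l A. apply parity in A as [h ->].
      destruct nU, nV;
      [ position (-1)%R (-1)%R 0%R 0%R h l | position (-1)%R 1%R 0%R 0%R h l
      | position 1%R (-1)%R 0%R 0%R h l | position 1%R 1%R 0%R 0%R h l ].
    + intros a b u v k l H; positions H;
      [ exists false, false, (2 * k), l | exists true, true, (2 * k), l
      | exists true, false, (2 * k), l | exists false, true, (2 * k), l ];
      (split; [unfold admissible; lia | intertwine]).
  - apply (has_type_diag m Gamma _ _ (1/4) 0 0 (1/2) Hm ltac:(lra) HG);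
      [exact centred_to | exact centred_from].
  - apply (has_type_diag m Gamma _ _ (1/4) 0 0 (1/2) Hm ltac:(lra) HG);
      [exact centred_to | exact centred_from].
Qed.

Definition side_preserving (n : species) (nU nV : bool) (k l : Z) : Prop :=
  admissible n nU nV k l /\ false = xorb (xorb nU nV) (flips n nV l).

Ltac solve_side_preserving :=
  unfold side_preserving, admissible, flips; cbn [xorb];
  repeat match goal with |- context [?x =? ?y] => destruct (Z.eqb_spec x y) end;
  cbn [xorb]; repeat split; try discriminate; try reflexivity; lia.

(** For 17, 25 and 27 both signs agree, which leaves translations and half-turns. For 19 u keeps its
    sign, and v is reversed exactly when k is odd. For 21 and 29 the signs differ exactly when l is
    odd, so every reflection becomes a glide with half shifts in both directions. *)
Lemma has_type_H1 (m : Z) (n : species) (Gamma : (point -> point) -> Prop) : m <> 0 ->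
  (forall f, Gamma f <->
     exists nU nV k l, side_preserving n nU nV k l /\ f = diag_map m nU nV k l) ->
  has_type Gamma (snd (roth_pair n)).
Proof.
  intros Hm HG. destruct n; cbn [roth_pair snd].
  - apply (has_type_diag m Gamma _ _ (1/2) 0 0 1 Hm ltac:(lra) HG).
    + intros nU nV k l [A E].
      destruct nU, nV; try discriminate E; apply parity in A as [h ->];
      [ position (-1)%R (-1)%R 0%R 0%R h l | position 1%R 1%R 0%R 0%R h l ].
    + intros a b u v k l H; positions H;
      [ exists false, false, (2 * k), l | exists true, true, (2 * k), l ];
      (split; [solve_side_preserving | intertwine]).
  (* The glides run along U, those of the standard pg along the second axis, so the matrix exchanges
     the coordinates. *)
  - apply (has_type_diag m Gamma _ _ 0 1 (1/2) 0 Hm ltac:(lra) HG).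
    + intros nU nV k l [A E].
      destruct nU, nV; try discriminate E; apply parity in A as [h ->];
      [ position (-1)%R 1%R 0%R (1/2)%R l h | position 1%R 1%R 0%R 0%R l h ].
    + intros a b u v k l H; positions H;
      [ exists false, false, (2 * l), k | exists false, true, (2 * l + 1), k ];
      (split; [solve_side_preserving | intertwine]).
  - apply (has_type_diag m Gamma _ _ (1/2) 0 0 (1/2) Hm ltac:(lra) HG).
    + intros nU nV k l [A E]. unfold flips in E.
      destruct (Z.eqb_spec (l mod 2) 1) as [L | L].
      * apply parity in L as [h' ->].
        destruct nU, nV; try discriminate E; apply parity in A as [h ->];
        [ position (-1)%R 1%R (1/2)%R (1/2)%R h h'
        | position 1%R (-1)%R (1/2)%R (1/2)%R h h' ].
      * assert (L' : l mod 2 = 0) by lia. apply parity in L' as [h' ->].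
        destruct nU, nV; try discriminate E; apply parity in A as [h ->];
        [ position (-1)%R (-1)%R 0%R 0%R h h' | position 1%R 1%R 0%R 0%R h h' ].
    + intros a b u v k l H; positions H;
      [ exists false, false, (2 * k), (2 * l) | exists true, true, (2 * k), (2 * l)
      | exists true, false, (2 * k + 1), (2 * l + 1)
      | exists false, true, (2 * k + 1), (2 * l + 1) ];
      (split; [solve_side_preserving | intertwine]).
  - apply (has_type_diag m Gamma _ _ (1/2) 0 0 1 Hm ltac:(lra) HG).
    + intros nU nV k l [A E].
      destruct nU, nV; try discriminate E; apply parity in A as [h ->];
      [ position (-1)%R (-1)%R 0%R 0%R h l | position 1%R 1%R 0%R 0%R h l ].
    + intros a b u v k l H; positions H;
      [ exists false, false, (2 * k), l | exists true, true, (2 * k), l ];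
      (split; [solve_side_preserving | intertwine]).
  - (* The translation lattice is centred, hence the skew basis. *)
    apply (has_type_diag m Gamma _ _ (1/2) 0 (-(1/4)) (1/2) Hm ltac:(lra) HG).
    + intros nU nV k l [A E].
      assert (B : exists h h', k = 2 * h /\ l = h + 2 * h').
      { exists (k / 2), ((l - k / 2) / 2). unfold admissible in A. lia. }
      destruct B as (h & h' & -> & ->).
      destruct nU, nV; try discriminate E;
      [ position (-1)%R (-1)%R 0%R 0%R h h' | position 1%R 1%R 0%R 0%R h h' ].
    + intros a b u v k l H; positions H;
      [ exists false, false, (2 * k), (k + 2 * l) | exists true, true, (2 * k), (k + 2 * l) ];
      (split; [solve_side_preserving | intertwine]).
  - apply (has_type_diag m Gamma _ _ (1/4) 0 0 (1/2) Hm ltac:(lra) HG).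
    + intros nU nV k l [A E]. unfold flips in E. unfold admissible in A.
      destruct (Z.eqb_spec (l mod 2) 1) as [L | L].
      * assert (B : exists h h', k = 4 * h + 2 /\ l = 2 * h' + 1)
          by (exists (k / 4), (l / 2); lia).
        destruct B as (h & h' & -> & ->).
        destruct nU, nV; try discriminate E;
        [ position (-1)%R 1%R (1/2)%R (1/2)%R h h'
        | position 1%R (-1)%R (1/2)%R (1/2)%R h h' ].
      * assert (B : exists h h', k = 4 * h /\ l = 2 * h')
          by (exists (k / 4), (l / 2); lia).
        destruct B as (h & h' & -> & ->).
        destruct nU, nV; try discriminate E;
        [ position (-1)%R (-1)%R 0%R 0%R h h' | position 1%R 1%R 0%R 0%R h h' ].
    + intros a b u v k l H; positions H;
      [ exists false, false, (4 * k), (2 * l) | exists true, true, (4 * k), (2 * l)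
      | exists true, false, (4 * k + 2), (2 * l + 1)
      | exists false, true, (4 * k + 2), (2 * l + 1) ];
      (split; [solve_side_preserving | intertwine]).
Qed.

Lemma species_weave (m : Z) (n : species) (F : Z -> Z -> bool) :
  2 <= m -> realizes m n F -> has_species (weave F) n.
Proof.
  intros Hm HF. split; [exact (order_weave m n F Hm HF)|].
  split; [|split; [|exact (stabilizers_weave m n F Hm HF)]].
  - apply (has_type_G1 m); [lia|]. intros f. split.
    + intros [r H]. apply (symmetry_iff m n) in H; auto.
      destruct H as (nU & nV & k & l & A & E & _). exists nU, nV, k, l. auto.
    + intros (nU & nV & k & l & A & ->). exact (symmetry_exists m n F nU nV k l Hm HF A).
  - apply (has_type_H1 m); [lia|]. intros f. unfold H1.
    rewrite (symmetry_iff m n F f side_e Hm HF). simpl. unfold side_preserving.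
    split; intros (nU & nV & k & l & H); exists nU, nV, k, l; tauto.
Qed.

(** * The colouring *)

Definition stripe_index (s : strand) : Z := match s with Warp i | Weft i => i / 2 end.

Definition stripe_colour (m : Z) (s : strand) : nat := Z.to_nat (stripe_index s mod (2 * m)).

Lemma stripe_colour_mod (m : Z) (s : strand) : 0 < m ->
  Z.of_nat (stripe_colour m s) = stripe_index s mod (2 * m).
Proof.
  intros Hm. unfold stripe_colour. apply Z2Nat.id. apply Z.mod_pos_bound. lia.
Qed.

(** On stripe indices the shifts mk + l onto warps and l - mk onto wefts differ by 2mk, and the sign
    is that of [nV] for both; hence one permutation modulo 2m serves all strands. *)
Lemma perfect_stripe_colour (m : Z) (n : species) (F : Z -> Z -> bool) :
  2 <= m -> realizes m n F -> perfect (weave F) (stripe_colour m).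
Proof.
  intros Hm HF t r H c. apply (symmetry_iff m n) in H; auto.
  destruct H as (nU & nV & k & l & _ & -> & _).
  set (img x := if nV then l - m * k - 1 - x else x + (l - m * k)).
  exists (Z.to_nat (img (Z.of_nat c) mod (2 * m))).
  intros s s' Hs M. apply maps_strand_gmap in M. subst s' c.
  unfold stripe_colour at 1. f_equal. rewrite stripe_colour_mod by lia.
  assert (E : exists q, stripe_index (gstrand (xorb nU nV) nV nV (2 * (m * k + l))
      (2 * (l - m * k)) s) = img (stripe_index s) + q * (2 * m)).
  { assert (A : forall p x, act nV (2 * p) x / 2 = if nV then p - 1 - x / 2 else x / 2 + p)
      by (intros p x; unfold act; destruct nV; lia).
    destruct s, (xorb nU nV); cbn [gstrand stripe_index]; rewrite A; unfold img;
      [exists 0 | exists k | exists k | exists 0]; destruct nV; ring. }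
  destruct E as [q ->]. rewrite Z_mod_plus_full. unfold img. destruct nV.
  - rewrite Zminus_mod_idemp_r. reflexivity.
  - rewrite Zplus_mod_idemp_l. reflexivity.
Qed.

Lemma thick_striping_stripe_colour (m : Z) : thick_striping (stripe_colour m).
Proof.
  intros a. unfold stripe_colour, stripe_index.
  replace ((2 * a + 1) / 2) with (2 * a / 2) by lia. auto.
Qed.

Lemma uses_colours_stripe_colour (m : nat) : (0 < m)%nat ->
  uses_colours (stripe_colour (Z.of_nat m)) (2 * m)%nat.
Proof.
  intros Hm. split.
  - intros s. pose proof (stripe_colour_mod (Z.of_nat m) s ltac:(lia)) as E.
    pose proof (Z.mod_pos_bound (stripe_index s) (2 * Z.of_nat m) ltac:(lia)). lia.
  - intros k Hk. split; exists (2 * Z.of_nat k); unfold stripe_colour, stripe_index;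
      replace (2 * Z.of_nat k / 2) with (Z.of_nat k) by lia;
      rewrite Z.mod_small by lia; apply Nat2Z.id.
Qed.

Lemma twill_stripe_colour (m : nat) : (0 < m)%nat ->
  redundant_blocks_doubled_twill (stripe_colour (Z.of_nat m)) (2 * m)%nat.
Proof.
  intros Hm. set (c := 2 * Z.of_nat m).
  exists (fun i j => (i - j) mod c =? 0). split.
  - exists (gmap false false false 0 0). split; [apply gmap_grid_isometry|].
    intros i j i' j' M.
    assert (M0 : maps_onto (gmap false false false 0 0) (cell i j) (cell i j)).
    { apply maps_onto_gmap. intros p. unfold gmap, cell. cbn [sgn fst snd].
      rewrite !Rmult_1_l, !Rplus_0_r. reflexivity. }
    destruct (cell_inj _ _ _ _ (maps_onto_unique _ _ _ _ M0 M)) as [<- <-].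
    replace (Z.of_nat (2 * m)) with c by (unfold c; lia).
    rewrite Z.eqb_eq. apply Z.mod_divide. unfold c; lia.
  - intros i j. unfold redundant_block, Defs.double. rewrite Z.eqb_eq.
    assert (E : forall x y, stripe_colour (Z.of_nat m) x = stripe_colour (Z.of_nat m) y <->
      stripe_index x mod c = stripe_index y mod c).
    { intros x y. unfold c. rewrite <- !stripe_colour_mod by lia. split; lia. }
    rewrite E. cbn [stripe_index].
    replace (2 * (i / 2) / 2) with (i / 2) by lia.
    replace (2 * (j / 2) / 2) with (j / 2) by lia.
    assert (Hc : c <> 0) by (unfold c; lia). split; intros H.
    + rewrite Zminus_mod, H, Z.sub_diag. reflexivity.
    + rewrite Z.mod_divide in H by exact Hc. destruct H as [q Hq].
      replace (i / 2) with (j / 2 + q * c) by lia. apply Z_mod_plus_full.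
Qed.

(** * The designs *)

Definition point_pattern (M : Z) (c : Z -> Z) (u v : Z) : bool :=
  if v mod 4 =? 0 then true else if v mod 4 =? 2 then false else (u - c v) mod M =? 0.

Lemma point_pattern_odd (M : Z) (c : Z -> Z) (u v : Z) : M <> 0 -> v mod 2 = 1 ->
  point_pattern M c u v = true <-> (M | u - c v).
Proof.
  intros HM Hv. unfold point_pattern.
  destruct (Z.eqb_spec (v mod 4) 0), (Z.eqb_spec (v mod 4) 2); try lia.
  rewrite Z.eqb_eq. apply Z.mod_divide, HM.
Qed.

Lemma point_pattern_even (M : Z) (c : Z -> Z) (u v : Z) : v mod 2 = 0 ->
  point_pattern M c u v = (v mod 4 =? 0).
Proof.
  intros Hv. unfold point_pattern.
  destruct (Z.eqb_spec (v mod 4) 0), (Z.eqb_spec (v mod 4) 2); try lia; reflexivity.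
Qed.

Lemma not_divide_small (d x : Z) : 0 < Z.abs x < d -> ~ (d | x).
Proof. intros H [q ->]. destruct (Z.eq_dec q 0); nia. Qed.

(** Even rows are constant and row 1 is not, so b is even; the image of row 0 then tells whether
    colours are exchanged, and following the dark cell of row 1 determines a. The last two
    hypotheses say that the admissible maps are those that respect the positions [c]. *)
Lemma point_pattern_realizes (m : Z) (n : species) (M : Z) (c : Z -> Z) : 2 <= m ->
  0 < M -> (8 * m | M) -> (forall nV l, flips n nV l = false) ->
  c 1 mod 2 = 0 -> (forall v, (8 * m | c (v + 4) - c v)) ->
  (forall nU nV k l v, admissible n nU nV k l -> v mod 2 = 1 ->
    (M | c (sgn nV * v + 4 * l) - sgn nU * c v - 4 * m * k)) ->
  (forall nU nV a l, (M | c (sgn nV * 1 + 4 * l) - sgn nU * c 1 - a) ->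
    exists k, a = 4 * m * k /\ admissible n nU nV k l) ->
  realizes m n (point_pattern M c).
Proof.
  intros Hm HM HmM Hfl Hc1 Hc Hinv Hex.
  assert (HM0 : M <> 0) by lia.
  (* Two cells four apart on one warp, in odd rows, cannot both be dark: 8m would divide 4. *)
  assert (Light : forall v u, v mod 2 = 1 -> exists x, (x = 0 \/ x = 4) /\
    point_pattern M c (u - x) (v + x) = false).
  { intros v u Hv. destruct (point_pattern M c u v) eqn:E0.
    2: { exists 0. split; [auto|]. rewrite Z.sub_0_r, Z.add_0_r. exact E0. }
    exists 4. split; [auto|]. apply not_true_iff_false. intros E4.
    apply point_pattern_odd in E0; try lia. apply point_pattern_odd in E4; try lia.
    assert (D : (8 * m | 4)).
    { replace 4 with ((u - c v) - (u - 4 - c (v + 4)) - (c (v + 4) - c v)) by ring.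
      apply Z.divide_sub_r; [|apply Hc].
      apply Z.divide_sub_r; apply (Z.divide_trans _ M); assumption. }
    revert D. apply not_divide_small. lia. }
  split.
  - intros nU nV k l u v A Huv. rewrite Hfl, xorb_false_l.
    destruct (Z.eq_dec (v mod 2) 0) as [Hv | Hv].
    + rewrite !point_pattern_even; [| lia | destruct nV; unfold sgn; lia].
      apply eq_true_iff_eq. rewrite !Z.eqb_eq. destruct nV; unfold sgn; lia.
    + apply eq_true_iff_eq. rewrite !point_pattern_odd; auto; try lia.
      2: destruct nV; unfold sgn; lia.
      specialize (Hinv nU nV k l v A ltac:(lia)).
      set (c' := c (sgn nV * v + 4 * l)) in *.
      split; intros H.
      * replace (u - c v) with
          (sgn nU * ((sgn nU * u + 4 * m * k - c') + (c' - sgn nU * c v - 4 * m * k)))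
          by (destruct nU; unfold sgn; ring).
        apply Z.divide_mul_r, Z.divide_add_r; assumption.
      * replace (sgn nU * u + 4 * m * k - c') with
          (sgn nU * (u - c v) - (c' - sgn nU * c v - 4 * m * k)) by ring.
        apply Z.divide_sub_r; [apply Z.divide_mul_r|]; assumption.
  - intros nU nV a b f Hab H.
    assert (Dark : point_pattern M c (c 1) 1 = true).
    { apply point_pattern_odd; [lia | reflexivity|]. rewrite Z.sub_diag. apply Z.divide_0_r. }
    assert (Sparse : forall v u x, (x = 2 \/ x = 4) -> v mod 2 = 1 ->
        point_pattern M c u v = true -> point_pattern M c (u + x) v = false).
    { intros v u x Hx Hv H1. apply not_true_iff_false. intros H2.
      apply point_pattern_odd in H1; auto. apply point_pattern_odd in H2; auto.
      assert (D : (8 * m | x)).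
      { apply (Z.divide_trans _ M); [assumption|].
        replace x with ((u + x - c v) - (u - c v)) by ring.
        apply Z.divide_sub_r; assumption. }
      revert D. apply not_divide_small. lia. }
    pose proof (H (c 1) 1 ltac:(lia)) as R0.
    pose proof (H (c 1 + 2) 1 ltac:(lia)) as R2.
    pose proof (H (c 1 + 4) 1 ltac:(lia)) as R4.
    pose proof (H 1 0 ltac:(lia)) as E0.
    rewrite Dark in R0. rewrite (Sparse 1 (c 1) 2) in R2 by auto.
    rewrite (Sparse 1 (c 1) 4) in R4 by auto.
    rewrite (point_pattern_even _ _ 1 0) in E0 by reflexivity.
    assert (Hb : b mod 2 = 0).
    { destruct (Z.eq_dec (b mod 2) 0) as [E | E]; [exact E | exfalso].
      rewrite point_pattern_even in R0 by (destruct nV; unfold sgn; lia).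
      rewrite point_pattern_even in R2 by (destruct nV; unfold sgn; lia).
      rewrite R0 in R2. destruct f; discriminate. }
    rewrite point_pattern_even in E0 by lia.
    rewrite Z.mul_0_r, Z.add_0_l in E0. destruct (Z.eqb_spec (b mod 4) 0) as [B | B].
    + assert (f = false) as -> by (destruct f; [discriminate E0 | reflexivity]).
      assert (L : b = 4 * (b / 4)) by lia. rewrite L in R0.
      apply point_pattern_odd in R0; [|lia | destruct nV; unfold sgn; lia].
      destruct (Hex nU nV a (b / 4)) as (k & -> & A).
      { apply Z.divide_opp_r in R0. eapply eq_ind; [exact R0 | ring]. }
      exists k, (b / 4). auto.
    (* An exchange of colours would turn two light cells of row 1 into dark cells at distance 2 in
       one odd row. *)
    + exfalso. assert (f = true) as -> by (destruct f; [reflexivity | discriminate E0]).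
      cbn [xorb] in R2, R4. destruct nU.
      * apply (Sparse _ _ 2) in R4; [|auto | destruct nV; unfold sgn; lia].
        revert R4.
        replace (sgn true * (c 1 + 4) + a + 2) with (sgn true * (c 1 + 2) + a)
          by (unfold sgn; ring). rewrite R2. discriminate.
      * apply (Sparse _ _ 2) in R2; [|auto | destruct nV; unfold sgn; lia].
        revert R2.
        replace (sgn false * (c 1 + 2) + a + 2) with (sgn false * (c 1 + 4) + a)
          by (unfold sgn; ring). rewrite R4. discriminate.
  (* A light cell of a row 3 modulo 4 has a cell of the next, dark row beside it on the same
     weft. *)
  - intros i. destruct (Light 3 (2 * i - 2) ltac:(reflexivity)) as (x & Hx & L).
    exists (2 - i + x). unfold weave. split.
    + rewrite <- L. f_equal; ring.
    + rewrite point_pattern_even by lia. apply Z.eqb_eq. lia.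
  - intros i. destruct (Light 1 (2 * i + 2) ltac:(reflexivity)) as (x & Hx & L).
    exists (- i - 1 + x). unfold weave. split.
    + rewrite point_pattern_even by lia. apply Z.eqb_eq. lia.
    + rewrite <- L. f_equal; ring.
Qed.

(** The dark cells sit at 2m in rows 1 modulo 4 and at -2m in rows 3, modulo 8m. Changing the sign
    of exactly one of u, v displaces them by 4m, so k must be odd. *)
Lemma realizes_sp17 (m : Z) : 2 <= m ->
  realizes m sp17 (point_pattern (8 * m) (fun v => if v mod 4 =? 1 then 2 * m else - (2 * m))).
Proof.
  intros Hm. apply point_pattern_realizes; auto; try lia.
  - exists 1. ring.
  - destruct (1 mod 4 =? 1); lia.
  - intros v. replace ((v + 4) mod 4) with (v mod 4) by lia. exists 0. ring.
  - intros nU nV k l v A Hv.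
    assert (E : ((sgn nV * v + 4 * l) mod 4 =? 1) = xorb nV (v mod 4 =? 1)).
    { destruct nV; unfold sgn; destruct (Z.eqb_spec (v mod 4) 1); cbn [xorb];
        [apply Z.eqb_neq | apply Z.eqb_eq | apply Z.eqb_eq | apply Z.eqb_neq]; lia. }
    rewrite E. apply parity in A as [h ->].
    destruct nU, nV, (v mod 4 =? 1); cbn [xorb]; unfold sgn;
      first [exists (- h); ring | exists (- h - 1); ring].
  - intros nU nV a l [q Hq].
    replace ((sgn nV * 1 + 4 * l) mod 4 =? 1) with (negb nV) in Hq.
    2: { destruct nV; unfold sgn; symmetry; [apply Z.eqb_neq | apply Z.eqb_eq]; lia. }
    change (1 mod 4 =? 1) with true in Hq. cbv iota in Hq. unfold admissible.
    exists (- (2 * q) + if nU then (if nV then 0 else 1) else if nV then -1 else 0).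
    destruct nU, nV; cbn [xorb negb sgn] in *; split; lia.
Qed.

Lemma realizes_sp25 (m : Z) : 2 <= m ->
  realizes m sp25 (point_pattern (8 * m) (fun _ => 0)).
Proof.
  intros Hm. apply point_pattern_realizes; auto; try lia.
  - exists 1. ring.
  - intros v. exists 0. ring.
  - intros nU nV k l v A Hv. apply parity in A as [h ->]. exists (- h). ring.
  - intros nU nV a l [q Hq]. exists (- (2 * q)). unfold admissible. split; lia.
Qed.

(** The dark cells sit at 0 in rows +-1 modulo 8 and at 8m in rows +-3, modulo 16m. A shift of v by
    4 therefore needs a shift of u by 8m, which centres the lattice. *)
Lemma realizes_sp27 (m : Z) : 2 <= m ->
  realizes m sp27 (point_pattern (16 * m) (fun v => if (v + 1) mod 8 <=? 2 then 0 else 8 * m)).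
Proof.
  intros Hm. apply point_pattern_realizes; auto; try lia.
  - exists 2. ring.
  - intros v. destruct ((v + 4 + 1) mod 8 <=? 2), ((v + 1) mod 8 <=? 2);
      first [exists 0; ring | exists 1; ring | exists (-1); ring].
  - intros nU nV k l v A Hv. unfold admissible in A.
    assert (E : ((sgn nV * v + 4 * l + 1) mod 8 <=? 2) =
      xorb (l mod 2 =? 1) ((v + 1) mod 8 <=? 2)).
    { destruct (Z.eqb_spec (l mod 2) 1), (Z.leb_spec ((v + 1) mod 8) 2); cbn [xorb];
        [apply Z.leb_gt | apply Z.leb_le | apply Z.leb_le | apply Z.leb_gt];
        destruct nV; unfold sgn; lia. }
    rewrite E.
    assert (K : exists h, k = 4 * h + 2 * (l mod 2)) by (exists (k / 4); lia).
    destruct K as [h ->].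
    destruct (Z.eqb_spec (l mod 2) 1) as [L | L];
      [rewrite L | replace (l mod 2) with 0 by lia];
      destruct nU, ((v + 1) mod 8 <=? 2); cbn [xorb sgn];
      first [exists (- h); ring | exists (- h - 1); ring | exists (- h + 1); ring].
  - intros nU nV a l [q Hq].
    assert (E : ((sgn nV * 1 + 4 * l + 1) mod 8 <=? 2) = negb (l mod 2 =? 1)).
    { destruct (Z.eqb_spec (l mod 2) 1); cbn [negb]; [apply Z.leb_gt | apply Z.leb_le];
        destruct nV; unfold sgn; lia. }
    rewrite E in Hq. change ((1 + 1) mod 8 <=? 2) with true in Hq. cbv iota in Hq.
    exists (- (4 * q) + 2 * (l mod 2)). unfold admissible.
    destruct (Z.eqb_spec (l mod 2) 1) as [L | L]; cbn [negb] in Hq.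
    + rewrite L. lia.
    + replace (l mod 2) with 0 by lia. lia.
Qed.

(** * Square waves and their symmetries *)

Definition square_wave (L u : Z) : bool := (u / L) mod 2 =? 0.

Lemma odd_add (x y : Z) : ((x + y) mod 2 =? 1) = xorb (x mod 2 =? 1) (y mod 2 =? 1).
Proof.
  destruct (Z.eqb_spec (x mod 2) 1), (Z.eqb_spec (y mod 2) 1); cbn [xorb];
    (apply Z.eqb_eq + apply Z.eqb_neq); lia.
Qed.

Lemma square_wave_odd (L u : Z) : square_wave L u = negb (u / L mod 2 =? 1).
Proof.
  unfold square_wave. generalize (u / L). intros q.
  destruct (Z.eqb_spec (q mod 2) 1); cbn [negb]; (apply Z.eqb_eq + apply Z.eqb_neq); lia.
Qed.

Lemma square_wave_translate (L u k : Z) : L <> 0 ->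
  square_wave L (u + k * L) = xorb (k mod 2 =? 1) (square_wave L u).
Proof.
  intros HL. rewrite !square_wave_odd, Z.div_add, odd_add by exact HL.
  destruct (k mod 2 =? 1), (u / L mod 2 =? 1); reflexivity.
Qed.

(** Parity keeps u off the multiples of L, where the wave jumps; there the floor of -u / L is -1
    minus that of u / L. *)
Lemma square_wave_opp (L u : Z) : L <> 0 -> L mod 2 = 0 -> u mod 2 = 1 ->
  square_wave L (- u) = negb (square_wave L u).
Proof.
  intros HL HL2 Hu. rewrite !square_wave_odd. f_equal.
  assert (N : u mod L <> 0).
  { intros E. apply Z.mod_divide in E as [q E]; [|exact HL].
    assert (L = 2 * (L / 2)) by lia. set (h := L / 2) in *. clearbody h. subst. lia. }
  rewrite Z.div_opp_l_nz by assumption. generalize (u / L). intros q.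
  destruct (Z.eqb_spec (q mod 2) 1); cbn [negb]; (apply Z.eqb_eq + apply Z.eqb_neq); lia.
Qed.

Lemma square_wave_act (L u k : Z) (nU : bool) : L <> 0 -> L mod 2 = 0 -> u mod 2 = 1 ->
  square_wave L (sgn nU * u + k * L) = xorb (xorb nU (k mod 2 =? 1)) (square_wave L u).
Proof.
  intros HL HL2 Hu. rewrite square_wave_translate by exact HL. destruct nU; unfold sgn.
  - replace (-1 * u) with (- u) by ring. rewrite square_wave_opp by assumption.
    destruct (k mod 2 =? 1), (square_wave L u); reflexivity.
  - rewrite Z.mul_1_l. reflexivity.
Qed.

Lemma square_wave_first_half (L u : Z) : 0 <= u < L -> square_wave L u = true.
Proof. intros H. unfold square_wave. rewrite Z.div_small by exact H. reflexivity. Qed.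

Lemma square_wave_second_half (L u : Z) : L <= u < 2 * L -> square_wave L u = false.
Proof.
  intros H. replace u with (u - L + 1 * L) by ring.
  rewrite square_wave_translate, square_wave_first_half by lia. reflexivity.
Qed.

Lemma square_wave_period (L a : Z) : 0 < L -> L mod 2 = 0 -> a mod 2 = 0 ->
  (forall u, u mod 2 = 1 -> square_wave L (u + a) = square_wave L u) ->
  exists q, a = 2 * q * L.
Proof.
  intros HL HL2 Ha H. exists (a / (2 * L)).
  pose proof (Z.div_mod a (2 * L) ltac:(lia)) as E.
  pose proof (Z.mod_pos_bound a (2 * L) ltac:(lia)) as B.
  set (q := a / (2 * L)) in *. set (r := a mod (2 * L)) in *. clearbody q r.
  assert (Hr : r mod 2 = 0).
  { assert (a = 2 * (L * q) + r) by lia. lia. }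
  assert (S : forall u, u mod 2 = 1 -> square_wave L (u + r) = square_wave L u).
  { intros u Hu. rewrite <- (H u Hu). replace (u + a) with (u + r + (2 * q) * L) by lia.
    rewrite square_wave_translate by lia.
    replace ((2 * q) mod 2) with 0 by lia. reflexivity. }
  destruct (Z.eq_dec r 0) as [-> | N]; [lia | exfalso].
  (* A nonzero even r < 2L takes the last odd point L - 1 of the first half into the second half if
     r <= L, and takes 1 there otherwise. *)
  destruct (Z.le_gt_cases r L) as [C | C].
  - specialize (S (L - 1) ltac:(lia)).
    rewrite square_wave_second_half, square_wave_first_half in S by lia. discriminate.
  - specialize (S 1 ltac:(reflexivity)).
    rewrite square_wave_second_half, square_wave_first_half in S by lia. discriminate.
Qed.

(** A reflection and a complement each amount to a shift by L on this wave; undoing [e] such shifts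
    leaves a genuine period. *)
Lemma square_wave_exact (L a : Z) (nU c : bool) : 0 < L -> L mod 2 = 0 -> a mod 2 = 0 ->
  (forall u, u mod 2 = 1 -> square_wave L (sgn nU * u + a) = xorb c (square_wave L u)) ->
  exists k, a = k * L /\ (k mod 2 =? 1) = xorb nU c.
Proof.
  intros HL HL2 Ha H. set (e := if xorb nU c then 1 else 0).
  destruct (square_wave_period L (a - e * L)) as [q Hq]; auto.
  - assert (L = 2 * (L / 2)) by lia. unfold e. destruct xorb; lia.
  - intros u Hu. replace (u + (a - e * L)) with (u + a + (- e) * L) by ring.
    rewrite square_wave_translate by lia.
    assert (E : square_wave L (u + a) = xorb (xorb nU c) (square_wave L u)).
    { destruct nU; unfold sgn in H.
      - replace (u + a) with (-1 * (- u) + a) by ring. rewrite H by lia.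
        rewrite square_wave_opp by lia. destruct c, (square_wave L u); reflexivity.
      - replace (u + a) with (1 * u + a) by ring. rewrite H by exact Hu. destruct c; reflexivity. }
    rewrite E. unfold e. destruct (xorb nU c), (square_wave L u); reflexivity.
  - exists (2 * q + e). split; [lia|].
    unfold e. destruct (xorb nU c); [apply Z.eqb_eq | apply Z.eqb_neq]; lia.
Qed.

(** * Wave patterns, for species 21 and 29 *)

(** [R false] and [R true] are the rows 2 and 6 modulo 8, between a dark band of rows -1, 0, 1 and a
    light band of rows 3, 4, 5. The shift of v by 4 exchanges the bands, while v |-> -v preserves
    them; both exchange the two wave rows. *)
Definition wave_pattern (R : bool -> Z -> bool) (u v : Z) : bool :=
  if v mod 4 =? 2 then R (v mod 8 =? 6) u else (v + 1) mod 8 <=? 2.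

(** Rows outside 2 modulo 4 are constant and row 2 is not, so 4 divides b; the image of row 0
    identifies the complement with the parity of l, and only the wave rows remain to be compared. *)
Lemma wave_pattern_realizes (m : Z) (n : species) (R : bool -> Z -> bool) :
  (forall nV l, flips n nV l = (l mod 2 =? 1)) ->
  (forall nU nV k l e u, admissible n nU nV k l -> u mod 2 = 1 ->
    R (xorb (xorb e nV) (l mod 2 =? 1)) (sgn nU * u + 4 * m * k) =
    xorb (l mod 2 =? 1) (R e u)) ->
  (forall nU nV a l, a mod 2 = 0 ->
    (forall u, u mod 2 = 1 ->
      R (xorb nV (l mod 2 =? 1)) (sgn nU * u + a) = xorb (l mod 2 =? 1) (R false u)) ->
    exists k, a = 4 * m * k /\ admissible n nU nV k l) ->
  (forall x, x mod 2 = 1 -> exists u, u mod 8 = x mod 8 /\ R false u = true) ->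
  (forall x, x mod 2 = 1 -> exists u, u mod 8 = x mod 8 /\ R true u = false) ->
  (exists u, u mod 2 = 1 /\ R false u = false) ->
  realizes m n (wave_pattern R).
Proof.
  intros Hfl Hinv Hex Hdark Hlight [ul [Hul Rul]].
  assert (Row : forall nV l v, v mod 4 = 2 ->
    ((sgn nV * v + 4 * l) mod 8 =? 6) = xorb (xorb (v mod 8 =? 6) nV) (l mod 2 =? 1)).
  { intros nV l v Hv.
    destruct (Z.eqb_spec (v mod 8) 6), (Z.eqb_spec (l mod 2) 1), nV; cbn [xorb]; unfold sgn;
      (apply Z.eqb_eq + apply Z.eqb_neq); lia. }
  split.
  - intros nU nV k l u v A Huv. rewrite Hfl. unfold wave_pattern.
    destruct (Z.eqb_spec (v mod 4) 2) as [Hv | Hv].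
    + replace ((sgn nV * v + 4 * l) mod 4 =? 2) with true
        by (symmetry; apply Z.eqb_eq; destruct nV; unfold sgn; lia).
      rewrite Row by exact Hv. apply Hinv; [exact A | lia].
    + replace ((sgn nV * v + 4 * l) mod 4 =? 2) with false
        by (symmetry; apply Z.eqb_neq; destruct nV; unfold sgn; lia).
      destruct (Z.eqb_spec (l mod 2) 1), (Z.leb_spec ((v + 1) mod 8) 2); cbn [xorb];
        (apply Z.leb_le + apply Z.leb_gt); destruct nV; unfold sgn; lia.
  - intros nU nV a b c Hab H.
    destruct (Hdark 1 ltac:(reflexivity)) as (ud & Hud & Rud).
    pose proof (H ud 2 ltac:(lia)) as E1. pose proof (H ul 2 ltac:(lia)) as E2.
    assert (Hb : b mod 4 = 0).
    { destruct (Z.eq_dec (b mod 4) 0) as [E | E]; [exact E | exfalso].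
      unfold wave_pattern in E1, E2.
      replace ((sgn nV * 2 + b) mod 4 =? 2) with false in E1, E2
        by (symmetry; apply Z.eqb_neq; destruct nV; unfold sgn; lia).
      rewrite E1 in E2. cbn in E2. rewrite Rud, Rul in E2. destruct c; discriminate E2. }
    assert (L : b = 4 * (b / 4)) by lia. set (l := b / 4) in *. clearbody l. subst b.
    assert (C : c = (l mod 2 =? 1)).
    { specialize (H 1 0 ltac:(reflexivity)). unfold wave_pattern in H.
      replace ((sgn nV * 0 + 4 * l) mod 4 =? 2) with false in H
        by (symmetry; apply Z.eqb_neq; lia).
      change (0 mod 4 =? 2) with false in H. change ((0 + 1) mod 8 <=? 2) with true in H.
      cbv iota in H. rewrite xorb_true_r in H. apply negb_sym in H. rewrite H.
      destruct (Z.eqb_spec (l mod 2) 1); cbn [negb];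
        [replace (((sgn nV * 0 + 4 * l + 1) mod 8 <=? 2)) with false
        |replace (((sgn nV * 0 + 4 * l + 1) mod 8 <=? 2)) with true]; try reflexivity;
        symmetry; [apply Z.leb_gt | apply Z.leb_le]; lia. }
    destruct (Hex nU nV a l) as (k & -> & A).
    + lia.
    + intros u Hu. specialize (H u 2 ltac:(lia)). unfold wave_pattern in H.
      replace ((sgn nV * 2 + 4 * l) mod 4 =? 2) with true in H
        by (symmetry; apply Z.eqb_eq; destruct nV; unfold sgn; lia).
      rewrite Row in H by reflexivity. rewrite <- C at 2. exact H.
    + exists k, l. rewrite Hfl. auto.
  (* On warp i one has u + v = 2i + 1, so this residue of u selects row 6 modulo 8, next to the dark
     row 7. *)
  - intros i. destruct (Hlight (2 * i + 1 - 6) ltac:(lia)) as (u & Hu & Ru).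
    exists (i - u). unfold weave, wave_pattern.
    replace ((i + (i - u) + 1) mod 4 =? 2) with true by (symmetry; apply Z.eqb_eq; lia).
    replace ((i + (i - u) + 1) mod 8 =? 6) with true by (symmetry; apply Z.eqb_eq; lia).
    replace ((i + 1 + (i - u) + 1) mod 4 =? 2) with false by (symmetry; apply Z.eqb_neq; lia).
    split; [rewrite <- Ru; f_equal; ring | apply Z.leb_le; lia].
  - intros i. destruct (Hdark (2 * i + 1 - 2) ltac:(lia)) as (u & Hu & Ru).
    exists (i - u). unfold weave, wave_pattern.
    replace ((i + (i - u) + 1) mod 4 =? 2) with true by (symmetry; apply Z.eqb_eq; lia).
    replace ((i + (i - u) + 1) mod 8 =? 6) with false by (symmetry; apply Z.eqb_neq; lia).
    replace ((i + 1 + (i - u) + 1) mod 4 =? 2) with false by (symmetry; apply Z.eqb_neq; lia).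
    split; [rewrite <- Ru; f_equal; ring | apply Z.leb_gt; lia].
Qed.

Lemma eqb_odd_iff (k : Z) (b : bool) :
  (k mod 2 =? 1) = b <-> k mod 2 = if b then 1 else 0.
Proof.
  destruct b; [rewrite Z.eqb_eq | rewrite Z.eqb_neq]; lia.
Qed.

(** The two wave rows are complementary. Changing the sign of u, changing that of v and shifting u
    by 4m each complement the wave, so k must be odd exactly when the signs differ. *)
Lemma realizes_sp21 (m : Z) : 2 <= m ->
  realizes m sp21 (wave_pattern (fun e u => xorb e (square_wave (4 * m) u))).
Proof.
  intros Hm. apply wave_pattern_realizes; auto.
  - intros nU nV k l e u A Hu. unfold admissible in A. apply eqb_odd_iff in A.
    replace (4 * m * k) with (k * (4 * m)) by ring.
    rewrite square_wave_act, A by lia.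
    destruct nU, nV, e, (l mod 2 =? 1), (square_wave (4 * m) u); reflexivity.
  - intros nU nV a l Ha H.
    destruct (square_wave_exact (4 * m) a nU nV) as (k & -> & K); try lia.
    + intros u Hu. specialize (H u Hu). revert H.
      destruct nV, (l mod 2 =? 1), (square_wave (4 * m) u),
        (square_wave (4 * m) (sgn nU * u + a)); simpl; congruence.
    + exists k. split; [ring|]. apply eqb_odd_iff, K.
  - intros x Hx. exists (x mod 8). rewrite square_wave_first_half by lia. split; [lia | reflexivity].
  - intros x Hx. exists (x mod 8). rewrite square_wave_first_half by lia. split; [lia | reflexivity].
  - exists (4 * m + 1). rewrite square_wave_second_half by lia. split; [lia | reflexivity].
Qed.

(** The phase 4m, a quarter of the period, makes the wave even in u; a shift of u by 8m complements
    it and so goes with odd l. *)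
Lemma realizes_sp29 (m : Z) : 2 <= m ->
  realizes m sp29 (wave_pattern (fun _ u => square_wave (8 * m) (u + 4 * m))).
Proof.
  intros Hm. apply wave_pattern_realizes; auto.
  - intros nU nV k l e u A Hu. unfold admissible in A.
    set (n1 := if nU then 1 else 0).
    replace (sgn nU * u + 4 * m * k + 4 * m)
      with (sgn nU * (u + 4 * m) + (k / 2 + n1) * (8 * m)).
    2: { assert (k = 2 * (k / 2)) by lia. unfold n1. destruct nU; unfold sgn; lia. }
    rewrite square_wave_act by lia. f_equal. rewrite odd_add.
    replace (k / 2 mod 2) with (l mod 2) by lia.
    unfold n1. destruct nU, (l mod 2 =? 1); reflexivity.
  - intros nU nV a l Ha H. set (n1 := if nU then 1 else 0).
    destruct (square_wave_exact (8 * m) (a + n1 * (8 * m)) nU (l mod 2 =? 1))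
      as (k & E & K); try lia.
    + intros u Hu. specialize (H (u - 4 * m) ltac:(lia)).
      replace (u - 4 * m + 4 * m) with u in H by ring. rewrite <- H. f_equal.
      unfold n1. destruct nU; unfold sgn; ring.
    + exists (2 * (k - n1)). split; [lia|]. apply eqb_odd_iff in K. unfold admissible, n1.
      destruct (Z.eqb_spec (l mod 2) 1), nU; cbn [xorb] in K; lia.
  - intros x Hx. exists (x mod 8). rewrite square_wave_first_half by lia. split; [lia | reflexivity].
  - intros x Hx. exists (4 * m + (x - 4 * m) mod 8). rewrite square_wave_second_half by lia.
    split; [lia | reflexivity].
  - exists (4 * m + 1). rewrite square_wave_second_half by lia. split; [lia | reflexivity].
Qed.

(** * The design for species 19 *)

(* Rows 0 and 2 modulo 4 must differ, otherwise [(u, v) |-> (u + 4m, v + 2)] would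
   be a further symmetry. *)
Definition pattern19 (L u v : Z) : bool :=
  if v mod 4 =? 0 then square_wave L u
  else if v mod 4 =? 2 then xorb (square_wave L u) ((u + 1) mod L <=? 2)
  else v mod 4 =? 1.

Lemma pattern19_row0 (L u v : Z) : v mod 4 = 0 -> pattern19 L u v = square_wave L u.
Proof. intros H. unfold pattern19. rewrite H. reflexivity. Qed.

Lemma pattern19_row2 (L u v : Z) : v mod 4 = 2 ->
  pattern19 L u v = xorb (square_wave L u) ((u + 1) mod L <=? 2).
Proof. intros H. unfold pattern19. rewrite H. reflexivity. Qed.

Lemma pattern19_odd (L u v : Z) : v mod 2 = 1 -> pattern19 L u v = (v mod 4 =? 1).
Proof.
  intros H. unfold pattern19.
  destruct (Z.eqb_spec (v mod 4) 0), (Z.eqb_spec (v mod 4) 2); lia || reflexivity.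
Qed.

(** The condition describes the integers within distance 1 of a multiple of L. *)
Lemma near_multiple_act (L u k : Z) (nU : bool) : 2 < L ->
  ((sgn nU * u + k * L + 1) mod L <=? 2) = ((u + 1) mod L <=? 2).
Proof.
  intros HL. replace (sgn nU * u + k * L + 1) with (sgn nU * u + 1 + k * L) by ring.
  rewrite Z_mod_plus_full. destruct nU; unfold sgn; [|rewrite Z.mul_1_l; reflexivity].
  pose proof (Z.div_mod (u + 1) L ltac:(lia)) as E.
  pose proof (Z.mod_pos_bound (u + 1) L ltac:(lia)) as B.
  set (q := (u + 1) / L) in *. set (r := (u + 1) mod L) in *. clearbody q r.
  destruct (Z.leb_spec r 2) as [H | H].
  - apply Z.leb_le. rewrite <- (Z.mod_unique (-1 * u + 1) L (- q) (2 - r)); lia.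
  - apply Z.leb_gt. rewrite <- (Z.mod_unique (-1 * u + 1) L (- q - 1) (L + 2 - r)); lia.
Qed.

(** An interval of length 4 < L contains at most one jump of the wave. *)
Lemma square_wave_runs (L w : Z) : 4 < L ->
  square_wave L (w - 2) = square_wave L (w + 2) -> square_wave L w = square_wave L (w + 2).
Proof.
  intros HL. unfold square_wave. intros H.
  pose proof (Z.div_le_mono (w - 2) w L ltac:(lia) ltac:(lia)) as H1.
  pose proof (Z.div_le_mono w (w + 2) L ltac:(lia) ltac:(lia)) as H2.
  pose proof (Z.div_le_mono (w + 2) (w - 2 + 1 * L) L ltac:(lia) ltac:(lia)) as H3.
  rewrite Z.div_add in H3 by lia.
  set (x := (w - 2) / L) in *. set (y := w / L) in *. set (z := (w + 2) / L) in *.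
  clearbody x y z. f_equal. f_equal.
  destruct (Z.eqb_spec (x mod 2) 0), (Z.eqb_spec (z mod 2) 0); try discriminate H; lia.
Qed.

(** The constant odd rows force b to be even. If b were 2 modulo 4, row 2, which is dark, light,
    dark at u = -1, 1, 3, would be the image of a pure wave up to complement, and such a wave has no
    isolated cell. Row 0 then determines a. *)
Lemma realizes_sp19 (m : Z) : 2 <= m -> realizes m sp19 (pattern19 (4 * m)).
Proof.
  intros Hm. set (L := 4 * m).
  assert (HL : 8 <= L) by (unfold L; lia). assert (HL2 : L mod 2 = 0) by (unfold L; lia).
  split.
  - intros nU nV k l u v A Huv. unfold admissible in A. apply eqb_odd_iff in A.
    replace (4 * m * k) with (k * L) by (unfold L; ring). unfold flips.
    destruct (Z.eq_dec (v mod 2) 1) as [Hv | Hv].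
    + rewrite !pattern19_odd; [| lia | destruct nV; unfold sgn; lia].
      destruct (Z.eqb_spec (v mod 4) 1), nV; cbn [xorb]; unfold sgn;
        (apply Z.eqb_eq + apply Z.eqb_neq); lia.
    + assert (E : square_wave L (sgn nU * u + k * L) = xorb nV (square_wave L u)).
      { rewrite square_wave_act, A by lia. destruct nU, nV; reflexivity. }
      destruct (Z.eq_dec (v mod 4) 0) as [H0 | H0].
      * rewrite !pattern19_row0; [exact E | lia | destruct nV; unfold sgn; lia].
      * rewrite !pattern19_row2; [| lia | destruct nV; unfold sgn; lia].
        rewrite E, near_multiple_act by lia. apply xorb_assoc.
  - intros nU nV a b c Hab H.
    assert (T : square_wave L 1 = true) by (apply square_wave_first_half; lia).
    assert (T3 : square_wave L 3 = true) by (apply square_wave_first_half; lia).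
    assert (F1 : square_wave L (-1) = false).
    { change (-1) with (- (1)). rewrite square_wave_opp, T by (lia || reflexivity). reflexivity. }
    assert (Hb : b mod 2 = 0).
    { destruct (Z.eq_dec (b mod 2) 0) as [E | E]; [exact E | exfalso].
      pose proof (H 1 0 ltac:(reflexivity)) as E1. pose proof (H (-1) 0 ltac:(reflexivity)) as E2.
      rewrite pattern19_odd in E1 by lia. rewrite pattern19_odd in E2 by lia.
      rewrite E1, !pattern19_row0, T, F1 in E2 by reflexivity. destruct c; discriminate E2. }
    assert (Hb4 : b mod 4 = 0).
    { destruct (Z.eq_dec (b mod 4) 0) as [E | E]; [exact E | exfalso].
      assert (X : forall x, x mod 2 = 1 -> square_wave L (sgn nU * (x - a)) =
        xorb c (xorb (square_wave L x) ((x + 1) mod L <=? 2))).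
      { intros x Hx. specialize (H (sgn nU * (x - a)) 0 ltac:(destruct nU; unfold sgn; lia)).
        rewrite pattern19_row2, pattern19_row0 in H by (lia || reflexivity).
        replace (sgn nU * (sgn nU * (x - a)) + a) with x in H
          by (destruct nU; unfold sgn; ring).
        rewrite H. destruct c, (square_wave L (sgn nU * (x - a))); reflexivity. }
      pose proof (X (-1) ltac:(reflexivity)) as X0. pose proof (X 1 ltac:(reflexivity)) as X1.
      pose proof (X 3 ltac:(reflexivity)) as X2.
      rewrite F1 in X0. rewrite T in X1. rewrite T3 in X2.
      replace ((-1 + 1) mod L <=? 2) with true in X0
        by (symmetry; apply Z.leb_le; rewrite Z.mod_small; lia).
      replace ((1 + 1) mod L <=? 2) with true in X1
        by (symmetry; apply Z.leb_le; rewrite Z.mod_small; lia).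
      replace ((3 + 1) mod L <=? 2) with false in X2
        by (symmetry; apply Z.leb_gt; rewrite Z.mod_small; lia).
      assert (Y : square_wave L (sgn nU * (1 - a)) = square_wave L (sgn nU * (1 - a) + 2)).
      { apply square_wave_runs; [lia|]. destruct nU; unfold sgn in *.
        - replace (-1 * (1 - a) - 2) with (-1 * (3 - a)) by ring.
          replace (-1 * (1 - a) + 2) with (-1 * (-1 - a)) by ring. rewrite X0, X2. reflexivity.
        - replace (1 * (1 - a) - 2) with (1 * (-1 - a)) by ring.
          replace (1 * (1 - a) + 2) with (1 * (3 - a)) by ring. rewrite X0, X2. reflexivity. }
      rewrite X1 in Y. destruct nU; unfold sgn in *.
      - replace (-1 * (1 - a) + 2) with (-1 * (-1 - a)) in Y by ring.
        rewrite X0 in Y. destruct c; discriminate Y.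
      - replace (1 * (1 - a) + 2) with (1 * (3 - a)) in Y by ring.
        rewrite X2 in Y. destruct c; discriminate Y. }
    assert (C : c = nV).
    { pose proof (H 0 1 ltac:(reflexivity)) as E.
      rewrite pattern19_odd in E by (destruct nV; unfold sgn; lia).
      rewrite pattern19_odd in E by reflexivity. change (1 mod 4 =? 1) with true in E. rewrite xorb_true_r in E.
      apply negb_sym in E. rewrite E. destruct nV; unfold sgn; 
        [replace ((-1 * 1 + b) mod 4) with 3 by lia | replace ((1 * 1 + b) mod 4) with 1 by lia];
        reflexivity. }
    destruct (square_wave_exact L a nU c) as (k & -> & K); try lia.
    + intros u Hu. specialize (H u 0 ltac:(lia)).
      rewrite !pattern19_row0 in H by (lia || reflexivity). exact H.
    + exists k, (b / 4). split; [unfold L; ring|]. split; [lia|].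
      split; [|exact C]. unfold admissible. apply eqb_odd_iff. rewrite K, C. reflexivity.
  - intros i. set (x := 4 - (2 * i + 1) mod 4).
    exists (i + x). unfold weave. split.
    + rewrite pattern19_row0 by (unfold x; lia). replace (i - (i + x)) with (- x) by ring.
      rewrite square_wave_opp, square_wave_first_half by (unfold x; lia). reflexivity.
    + rewrite pattern19_odd by (unfold x; lia). apply Z.eqb_eq. unfold x; lia.
  (* Here u is 3 or 5, beyond the altered cell at 1 and still in the first half of the wave, so row
     2 is dark there. *)
  - intros i. set (u := 2 + (2 * i - 3) mod 4).
    exists (i - u). unfold weave. split.
    + rewrite pattern19_row2 by (unfold u; lia). replace (i - (i - u)) with u by ring.
      rewrite square_wave_first_half by (unfold u; lia).
      rewrite Z.mod_small by (unfold u; lia).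
      replace (u + 1 <=? 2) with false; [reflexivity|].
      symmetry. apply Z.leb_gt. unfold u; lia.
    + rewrite pattern19_odd by (unfold u; lia). apply Z.eqb_neq. unfold u; lia.
Qed.

Lemma realization (m : Z) (n : species) : 2 <= m -> exists F, realizes m n F.
Proof.
  intros Hm. destruct n; eexists.
  - exact (realizes_sp17 m Hm).
  - exact (realizes_sp19 m Hm).
  - exact (realizes_sp21 m Hm).
  - exact (realizes_sp25 m Hm).
  - exact (realizes_sp27 m Hm).
  - exact (realizes_sp29 m Hm).
Qed.

Theorem theorem5 (m : nat) (hm : (2 <= m)%nat) (n : species) :
  exists D : design,
    isonemal D /\ fabric D /\ has_species D n /\
    exists col : colouring,
      thick_striping col /\ uses_colours col (2 * m)%nat /\
      perfect D col /\ redundant_blocks_doubled_twill col (2 * m)%nat.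
Proof.
  assert (Hm : 2 <= Z.of_nat m) by lia.
  destruct (realization (Z.of_nat m) n Hm) as [F HF].
  exists (weave F). split; [exact (isonemal_weave _ _ _ Hm HF)|].
  split; [exact (fabric_weave _ _ _ Hm HF)|].
  split; [exact (species_weave _ _ _ Hm HF)|].
  exists (stripe_colour (Z.of_nat m)).
  split; [apply thick_striping_stripe_colour|].
  split; [apply uses_colours_stripe_colour; lia|].
  split; [exact (perfect_stripe_colour _ _ _ Hm HF)|].
  apply twill_stripe_colour; lia.
Qed.
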